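(* Let $P$ be any quadrilateral in the Euclidean plane $\mathbb{R}^2$, with boundary $\Gamma$. Then $$L(\Gamma)\;\geq\; \frac{4}{3}\sqrt{3+2\sqrt{3}}\cdot \delta(\Gamma),$$ with equality if and only if $P$ is a magic kite. In other words, a magic kite has the minimal perimeter among all quadrilaterals with a given self Chebyshev radius of their boundaries.
   Context: $d$ is the Euclidean distance on $\mathbb{R}^2$. A quadrilateral is a (not necessarily convex) simple polygon with exactly four vertices; $L(\Gamma)$ is the length of its boundary $\Gamma$ (the perimeter). For a nonempty compact set $\Gamma\subset\mathbb{R}^2$, the self Chebyshev radius is $\delta(\Gamma)=\min_{x\in\Gamma}\max_{y\in\Gamma} d(x,y)$. A magic kite is a quadrilateral similar to the convex quadrilateral with the four vertices $(-1,0)$, $(1,0)$, $\left(0,\frac{\sqrt{3}}{3}\sqrt{2\sqrt{3}+3}\right)$, $\left(0,-\frac{1}{3}\sqrt{2\sqrt{3}-3}\right)$. *)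

(* Defs.v *)
From HB Require Import structures.
From mathcomp Require Import all_boot all_order all_algebra.
From mathcomp Require Import all_classical all_reals all_analysis.
From mathcomp Require Import ring lra.

Set Implicit Arguments.
Unset Strict Implicit.
Unset Printing Implicit Defensive.

Import Order.TTheory GRing.Theory Num.Theory.
Import numFieldNormedType.Exports.

Local Open Scope classical_set_scope.
Local Open Scope ring_scope.

Section Plane.
Context {R : realType}.
Implicit Types (x y z : 'rV[R]_2) (A : set 'rV[R]_2) (v : 'I_4 -> 'rV[R]_2).

Definition vec2 (a b : R) : 'rV[R]_2 := \row_(j < 2) [:: a; b]`_j.

(* The library norm on 'rV_2 is the sup norm, so the Euclidean distance is
   written out; both induce the same topology. *)
Definition dist x y : R := Num.sqrt (\sum_(j < 2) (x 0 j - y 0 j) ^+ 2).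

Definition segment x y : set 'rV[R]_2 :=
  [set (1 - t) *: x + t *: y | t in `[0, 1]].

(* For nonempty compact A the infimum and the suprema are attained: see
   self_chebyshev_radius_attained below. *)
Definition self_chebyshev_radius A : R :=
  inf [set sup [set dist x y | y in A] | x in A].

(* v lists the vertices of a closed polygonal line in cyclic order
   (ordS is the cyclic successor on 'I_4). *)
Definition side v (i : 'I_4) : set 'rV[R]_2 := segment (v i) (v (ordS i)).

Definition boundary v : set 'rV[R]_2 := \bigcup_i side v i.

Definition perimeter v : R := \sum_i dist (v i) (v (ordS i)).

(* The first two conditions say that the closed polygonal line is simple. The
   last one says that none of the four points is a flat corner (angle pi), so
   that the polygon has exactly four vertices. Together they imply that the
   vertices are pairwise distinct. *)
Definition is_quadrilateral v : Prop :=
  [/\ forall i, side v i `&` side v (ordS i) = [set v (ordS i)],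
      forall i, side v i `&` side v (ordS (ordS i)) = set0 &
      forall i, ~ segment (v i) (v (ordS (ordS i))) (v (ordS i))].

Definition is_similarity (f : 'rV[R]_2 -> 'rV[R]_2) : Prop :=
  exists2 k : R, 0 < k & forall x y, dist (f x) (f y) = k * dist x y.

(* The vertices of the convex kite in cyclic order; its diagonals lie on the
   coordinate axes. *)
Definition kite (i : 'I_4) : 'rV[R]_2 :=
  [:: vec2 (-1) 0;
      vec2 0 (Num.sqrt 3 / 3 * Num.sqrt (2 * Num.sqrt 3 + 3));
      vec2 1 0;
      vec2 0 (- (1 / 3 * Num.sqrt (2 * Num.sqrt 3 - 3)))]`_i.

(* Similarity is expressed on the boundary curves, hence independently of how
   the vertices are labelled. *)
Definition is_magic_kite v : Prop :=
  is_quadrilateral v /\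
  exists2 f, is_similarity f & boundary v = f @` boundary kite.

Lemma distE x y :
  dist x y = Num.sqrt ((x 0 0 - y 0 0) ^+ 2 + (x 0 1 - y 0 1) ^+ 2).
Proof.
rewrite /dist !big_ord_recl big_ord0 addr0.
by congr (Num.sqrt (_ + (x 0 _ - y 0 _) ^+ 2)); apply/val_inj.
Qed.

Lemma dist_ge0 x y : 0 <= dist x y.
Proof. exact: sqrtr_ge0. Qed.

Lemma distC x y : dist x y = dist y x.
Proof. by rewrite !distE; congr Num.sqrt; ring. Qed.

Lemma distxx x : dist x x = 0.
Proof. by rewrite distE !subrr !expr0n /= addr0 sqrtr0. Qed.

Lemma dist_triangle y x z : dist x z <= dist x y + dist y z.
Proof.
have p := dist_ge0 x y; have q := dist_ge0 y z.
rewrite -(ler_pXn2r (n := 2)) ?nnegrE ?dist_ge0 ?addr_ge0 ?dist_ge0//.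
have dd u w : dist u w ^+ 2 = (u 0 0 - w 0 0) ^+ 2 + (u 0 1 - w 0 1) ^+ 2.
  by rewrite distE sqr_sqrtr// addr_ge0 ?sqr_ge0.
rewrite sqrrD !dd.
suff cs : (x 0 0 - y 0 0) * (y 0 0 - z 0 0) + (x 0 1 - y 0 1) * (y 0 1 - z 0 1)
          <= dist x y * dist y z by rewrite -mulr_natr; nra.
set a := _ - _; set b := _ - _; set c := _ - _; set d := _ - _.
have [h|h] := leP (a * b + c * d) 0; first by rewrite (le_trans h) ?mulr_ge0.
rewrite -(ler_pXn2r (n := 2)) ?nnegrE ?mulr_ge0 ?(ltW h)//.
rewrite exprMn !dd -/a -/b -/c -/d.
by have := sqr_ge0 (a * d - b * c); nra.
Qed.

Lemma dist_continuous x : continuous (dist x).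
Proof.
pose g (w : 'rV[R]_2) : R := (x 0 0 - w 0 0) * (x 0 0 - w 0 0) +
                (x 0 1 - w 0 1) * (x 0 1 - w 0 1).
have -> : dist x = Num.sqrt \o g.
  by apply/funext => w; rewrite distE !expr2.
move=> y; apply: continuous_comp; last exact: sqrt_continuous.
have coordB j : (fun w : 'rV[R]_2 => x 0 j - w 0 j) @ y --> x 0 j - y 0 j.
  exact: cvgB (cvg_cst (x 0 j)) (@coord_continuous _ _ _ 0 j y).
exact: cvgD (cvgM (coordB 0) (coordB 0)) (cvgM (coordB 1) (coordB 1)).
Qed.

Lemma farthest_attained A x : compact A -> A !=set0 ->
  exists2 y, A y & sup [set dist x y | y in A] = dist x y /\
                   forall z, A z -> dist x z <= dist x y.
Proof.
move=> cA A0; have [|y /set_mem Ay ymax] := @compact_EVT_max _ _ (dist x) A A0 cA.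
  exact/continuous_subspaceT/dist_continuous.
have ub z : A z -> dist x z <= dist x y by move=> Az; apply: ymax; exact/mem_set.
exists y => //; split=> //; apply/eqP; rewrite eq_le; apply/andP; split.
  by apply: ge_sup => [|_ [z Az <-]]; [exists (dist x y), y|exact: ub].
apply: ub_le_sup; last by exists y.
by exists (dist x y) => _ [z Az <-]; exact: ub.
Qed.

Lemma self_chebyshev_radius_attained A : compact A -> A !=set0 ->
  exists x y, [/\ A x, A y, self_chebyshev_radius A = dist x y,
    forall z, A z -> dist x z <= dist x y &
    forall x', A x' -> exists2 y', A y' & dist x y <= dist x' y'].
Proof.
move=> cA A0; pose F x := sup [set dist x y | y in A].
have F_lip x x' : F x <= F x' + dist x x'.
  have [y Ay [Fx _]] := farthest_attained x cA A0.
  have [y' Ay' [Fx' h]] := farthest_attained x' cA A0.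
  by have := h _ Ay; have := dist_triangle x' x y; rewrite /F Fx Fx'; lra.
have F_cont : continuous F.
  move=> x; apply/(@cvgrPdist_le _ _ _ _ (nbhs_filter x)) => e e0.
  have /(@cvgrPdist_le _ _ _ _ (nbhs_filter x))/(_ e e0) dist_near :=
    @dist_continuous x x.
  near=> x'; have : `|dist x x - dist x x'| <= e by near: x'.
  rewrite distxx sub0r normrN (ger0_norm (dist_ge0 _ _)) => xx'.
  rewrite ler_norml; have := F_lip x x'; have := F_lip x' x.
  by rewrite (distC x' x) => ? ?; apply/andP; split; lra.
have [|x /set_mem Ax xmin] := @compact_EVT_min _ _ F A A0 cA.
  exact/continuous_subspaceT.
have min x' : A x' -> F x <= F x' by move=> Ax'; apply: xmin; exact/mem_set.
have [y Ay [Fx h]] := farthest_attained x cA A0.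
exists x, y; split=> //; last first.
  move=> x' Ax'; have [y' Ay' [Fx' _]] := farthest_attained x' cA A0.
  by exists y' => //; rewrite -Fx -Fx'; exact: min.
rewrite -Fx -/(F x); apply/eqP; rewrite eq_le; apply/andP; split.
  apply: ge_inf; last by exists x.
  by exists (F x) => _ [x' Ax' <-]; exact: min.
by apply: lb_le_inf => [|_ [x' Ax' <-]]; [exists (F x), x|exact: min].
Unshelve. all: by end_near.
Qed.

Lemma boundary_compact v : compact (boundary v).
Proof.
rewrite /boundary -bigsetU_fset_set; last exact: finite_finset.
apply: bigsetU_compact => i _; apply: continuous_compact; last exact: segment_compact.
apply: continuous_subspaceT => t.
by apply: cvgD; apply: cvgZr_tmp; first apply: cvgB; (exact: cvg_cst || exact: cvg_id).
Qed.

Lemma boundary_nonempty v : boundary v !=set0.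
Proof.
exists (v ord0), ord0 => //; exists 0; first by rewrite /= in_itv /= lexx ler01.
by rewrite subr0 scale1r scale0r addr0.
Qed.

End Plane.

(* Main.v *)
Require Import Defs.
From HB Require Import structures.
From mathcomp Require Import all_boot all_order all_algebra.
From mathcomp Require Import all_classical all_reals all_analysis.
From mathcomp Require Import ring lra.
Import Order.TTheory GRing.Theory Num.Theory.
Import numFieldNormedType.Exports.
Local Open Scope ring_scope.

(** After scaling, the self Chebyshev radius is 1: every point of the boundary is at distance at
    least 1 from one of the vertices A, B, C, D. Since 339/100 exceeds the optimal constant
    (4/3) sqrt (3 + 2 sqrt 3), configurations of perimeter at least 339/100 may be discarded.

    On a side AB every point is then at distance at least 1 from C or from D, so that AB is away
    from C, away from D, or mixed (partly close to each). Estimates for mixed sides show that some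
    vertex, say B, is such that AB is away from C and BC is away from A. In the frame where B = 0
    and the bisector of the angle 2θ at B is the second axis, this says that the legs a = AB and
    b = BC are at least 1 / sin 2θ. Projecting AD and CD on two mirror directions bounds the
    perimeter below by an expression that is affine in the coordinates of D. For moderate θ the
    direction (sin 3θ, - cos 3θ) gives 4 cos θ / sin 3θ, whose minimum over θ is the optimal
    constant, attained by the kite only; for the other angles, and when D is not separated from B,
    a fixed direction already gives 339/100.

    For the converse, a similarity carries the vertices of the kite to those of the polygon because
    they are the extreme points of its boundary, and the sides to the sides because the diagonals
    leave the boundary; and each point of the kite is far enough from an opposite vertex. *)

(** * Scalar inequalities *)

(** The direction (sin 3θ, - cos 3θ) comes from the extremal shape. When a = 1 / sin 2θ, the
    tangents from A to the unit circle around B are the parallel to BC and a line of exactly that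
    direction. If AD runs along the latter, projecting it loses nothing. [kite_side] shows that no
    other tilt of AD pays: one way y grows, the other way the growth of a outweighs what y saves.

    The optimal constant is about 3.3899. Many discarded shapes contain a triangle with two sides of
    length at least 1 and a nonacute angle between them, hence of perimeter at least 2 + sqrt 2;
    this explains the cut-off 339/100 and the recurring 139/100 < sqrt 2.

    No trigonometric function appears: an angle is given by its sine and cosine, and the cosine is
    bounded above by tangents to the unit circle at rational points, which leaves polynomial
    inequalities in the sine. *)

Section Scalar.
Context {R : realFieldType}.
Implicit Types (S C L a b d e h k m p q r w x y z : R).

Lemma sqr_le p q : 0 <= p -> p <= q -> p ^+ 2 <= q ^+ 2.
Proof. by move=> p0 pq; rewrite ler_pXn2r ?nnegrE //; lra. Qed.

Lemma sqr_lt p q : 0 <= p -> p < q -> p ^+ 2 < q ^+ 2.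
Proof. by move=> p0 pq; rewrite ltr_pXn2r ?nnegrE //; lra. Qed.

Lemma sqr_le_cancel p q : 0 <= q -> p ^+ 2 <= q ^+ 2 -> p <= q.
Proof.
move=> q0 pq; case: (lerP p 0) => p0; first by lra.
by rewrite -(ler_pXn2r (n := 2)) ?nnegrE ?(ltW p0).
Qed.

(* [e] is the length of a mixed side and [d] that of the opposite side. *)
Lemma trapezoid_final e d : 0 <= d < 1 -> 1 <= e ->
  1 + (e - d) ^+ 2 / 4 <= e ^+ 2 \/ d <= 1 / 2 /\ 1 + (1 - 2 * d) ^+ 2 <= e ^+ 2
   \/ 1 / 2 <= d ->
  (339 / 100 - e - d) ^+ 2 <= (2 - d ^+ 2 / 2) ^+ 2 + (e - d) ^+ 2.
Proof.
move=> d01 e1 cases.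
(* The difference of the two sides is this expression plus [d ^+ 4 / 4]. It is affine and increasing
   in [e], and each case bounds [e] below by an affine function of [d]. *)
suff : 0 <= 4 - 2 * d ^+ 2 + (339 / 100 - 2 * d) * (2 * e - 339 / 100).
  have d4 : 0 <= d ^+ 4 / 4 by rewrite divr_ge0 // exprn_even_ge0.
  by lra.
case: cases => [C|[[d2 C]|C]].
- have e2 : 115 / 100 - 3 / 10 * d <= e.
    by apply: sqr_le_cancel; [lra|]; nra.
  by nra.
- have e2 : 13 / 10 - 3 / 4 * d <= e.
    by apply: sqr_le_cancel; [lra|]; have := sqr_ge0 (d - 3 / 10); lra.
  by nra.
- by nra.
Qed.

(** Here [s] is the sum of the heights of A and D over the mixed side and [y] = AB + CD. Laying AB
    and a mirrored CD end to end gives a vector with components [m] and [s], of length at most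
    [y]. *)
Lemma trapezoid_scalar e d y s m : 0 <= d < 1 -> 1 <= e ->
  4 <= d ^+ 2 + 2 * s -> e - d <= m -> 0 <= y -> m ^+ 2 + s ^+ 2 <= y ^+ 2 ->
  1 + (e - d) ^+ 2 / 4 <= e ^+ 2 \/ d <= 1 / 2 /\ 1 + (1 - 2 * d) ^+ 2 <= e ^+ 2
   \/ 1 / 2 <= d ->
  339 / 100 <= e + d + y.
Proof.
move=> d01 e1 H em y0 Y cases.
have /trapezoid_final : 0 <= d < 1 by [].
move=> /(_ _ e1 cases) F.
have m2 : (e - d) ^+ 2 <= m ^+ 2 by apply: sqr_le; lra.
have dd : d ^+ 2 <= 1 by have := sqr_le d 1; rewrite expr1n; apply; lra.
have s2 : (2 - d ^+ 2 / 2) ^+ 2 <= s ^+ 2 by apply: sqr_le; lra.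
suff : 339 / 100 - e - d <= y by lra.
by apply: sqr_le_cancel => //; lra.
Qed.

Lemma circle_tangent S C (s c : R) : S ^+ 2 + C ^+ 2 = 1 -> s ^+ 2 + c ^+ 2 = 1 ->
  S * s + C * c <= 1.
Proof. by move=> h1 h2; have := sqr_ge0 (S - s); have := sqr_ge0 (C - c); lra. Qed.

(** The tangent at (3/5, 4/5) serves S >= 1/2; the next one, at (5/13, 12/13), serves S <= 1/2.
    Pythagorean triples keep them rational. *)
Lemma cos_le34 S C : S ^+ 2 + C ^+ 2 = 1 -> C <= 5 / 4 - 3 / 4 * S.
Proof.
move=> h; have E : (3 / 5) ^+ 2 + (4 / 5) ^+ 2 = 1 :> R by field.
by have := circle_tangent S C (3 / 5) (4 / 5) h E; lra.
Qed.

Lemma cos_le512 S C : S ^+ 2 + C ^+ 2 = 1 -> C <= 13 / 12 - 5 / 12 * S.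
Proof.
move=> h; have E : (5 / 13) ^+ 2 + (12 / 13) ^+ 2 = 1 :> R by field.
by have := circle_tangent S C (5 / 13) (12 / 13) h E; lra.
Qed.

(* On the unit circle the linear form increases with [p] until its maximum, in the direction
   [(al, ga)]. *)
Lemma arc_linear p q p0 q0 (al ga : R) : p ^+ 2 + q ^+ 2 = 1 -> p0 ^+ 2 + q0 ^+ 2 = 1 ->
  0 < q0 -> 0 <= p0 -> 0 < al -> 0 <= ga -> p < p0 -> ga * p0 < al * q0 ->
  al * p + ga * q < al * p0 + ga * q0.
Proof.
move=> u u0 q00 p00 al0 ga0 pp gp.
suff : ga * (q - q0) < al * (p0 - p) by lra.
case: (lerP q q0) => qq.
  have : 0 <= ga * (q0 - q) by apply: mulr_ge0; lra.
  have : 0 < al * (p0 - p) by apply: mulr_gt0; lra.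
  by lra.
have E : (q - q0) * (q + q0) = (p0 - p) * (p0 + p) by lra.
rewrite -(ltr_pM2r (_ : 0 < 2 * q0)); last by lra.
have h1 : ga * (q - q0) * (2 * q0) <= ga * ((q - q0) * (q + q0)).
  rewrite -mulrA; apply: ler_wpM2l => //; apply: ler_wpM2l; lra.
have h2 : ga * ((p0 - p) * (p0 + p)) <= (p0 - p) * (2 * (ga * p0)).
  have : 0 <= ga * ((p0 - p) * (p0 - p)) by apply: mulr_ge0 => //; apply: mulr_ge0; lra.
  by lra.
have h3 : (p0 - p) * (2 * (ga * p0)) < (p0 - p) * (2 * (al * q0)).
  by rewrite ltr_pM2l; lra.
by rewrite E in h1; lra.
Qed.

(** The hypotheses add up to a + b >= 1 / (S C), and S C is small enough here for the projection
    direction (1, 0) to suffice. *)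
Lemma narrow_bound S C a b : S ^+ 2 + C ^+ 2 = 1 -> 0 < S <= 1 / 2 -> 0 < C ->
  1 <= 2 * S * C * a -> 1 <= 2 * S * C * b -> 339 / 100 <= (a + b) * (1 + S).
Proof.
move=> h S01 C0 ha hb.
have SC : 0 < S * C by apply: mulr_gt0; lra.
have k : 339 / 100 * (S * C) <= 1 + S.
  have := cos_le512 S C h => Ch.
  have : S * C <= S * (13 / 12 - 5 / 12 * S) by apply: ler_wpM2l; lra.
  by have := sqr_ge0 (S - 1 / 2); lra.
have ab : 1 <= (a + b) * (S * C) by lra.
have ab0 : 0 < a + b by rewrite -(pmulr_lgt0 _ SC); lra.
have : (a + b) * (339 / 100 * (S * C)) <= (a + b) * (1 + S) by apply: ler_wpM2l; lra.
by lra.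
Qed.

(* The factor [1 + S * k1 - C * k2] of [perimeter_project] in the direction (35/37, 12/37). *)
Definition lam S C := 1 + 35 / 37 * S - 12 / 37 * C.

Lemma wide_facts S C a b (u : S ^+ 2 + C ^+ 2 = 1) (S2 : 1 / 2 <= S) (C0 : S <= C)
  (ha : 1 <= 2 * S * C * a) (hb : 1 <= 2 * S * C * b) :
  [/\ 0 < S * C, 2 * S * C <= 1, 1 <= a, 1 <= b & 1 < lam S C].
Proof.
have SC : 0 < S * C by apply: mulr_gt0; lra.
have SC2 : 2 * S * C <= 1 by have := sqr_ge0 (S - C); lra.
split=> //.
- rewrite leNgt; apply/negP => lt1.
  have : S * C * a < S * C * 1 by rewrite ltr_pM2l.
  by lra.
- rewrite leNgt; apply/negP => lt1.
  have : S * C * b < S * C * 1 by rewrite ltr_pM2l.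
  by lra.
- by have := cos_le34 S C u; rewrite /lam; lra.
Qed.

(** Since a + b >= 1 / (S C), it suffices that m S C <= [lam S C]. Replacing C by its tangent bound
    only makes this harder and leaves a polynomial in S. *)
Lemma lam_bound S C a b (u : S ^+ 2 + C ^+ 2 = 1) (S2 : 1 / 2 <= S) (C0 : S <= C)
  (ha : 1 <= 2 * S * C * a) (hb : 1 <= 2 * S * C * b) m : 0 <= m ->
  m * (S * (5 / 4 - 3 / 4 * S)) <= 1 + 35 / 37 * S - 12 / 37 * (5 / 4 - 3 / 4 * S) ->
  m <= (a + b) * lam S C.
Proof.
move=> m0 H; have [SC _ a1 b1 l1] := wide_facts S C a b u S2 C0 ha hb.
have Ch := cos_le34 S C u.
have h : m * (S * C) <= lam S C.
  apply: le_trans (_ : _ <= m * (S * (5 / 4 - 3 / 4 * S))) _.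
    by apply: ler_wpM2l => //; apply: ler_wpM2l; lra.
  by rewrite /lam; lra.
have : 1 * m <= (a + b) * (S * C) * m by apply: ler_wpM2r; lra.
have : (a + b) * (m * (S * C)) <= (a + b) * lam S C by apply: ler_wpM2l; lra.
by lra.
Qed.

(** The bounds [wide_y1] to [wide_y4] trade the angle against the height y of D. In [wide_y2],
    1054/1000 is just below sqrt (10/9); in [wide_y3], 25/24 comes from the threshold direction
    (7/25, 24/25). *)
Lemma wide_y1 S C a b (u : S ^+ 2 + C ^+ 2 = 1) (S2 : 1 / 2 <= S) (C0 : S <= C)
  (ha : 1 <= 2 * S * C * a) (hb : 1 <= 2 * S * C * b) y :
  63 / 100 <= S -> 1 <= y -> 339 / 100 <= (a + b) * lam S C + 24 / 37 * y.
Proof.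
move=> hS hy; have : 339 / 100 - 24 / 37 <= (a + b) * lam S C.
  by apply: (lam_bound S C a b u S2 C0 ha hb); move: hS S2 C0; clear; [lra | nra].
by lra.
Qed.

Lemma wide_y2 S C a b (u : S ^+ 2 + C ^+ 2 = 1) (S2 : 1 / 2 <= S) (C0 : S <= C)
  (ha : 1 <= 2 * S * C * a) (hb : 1 <= 2 * S * C * b) y :
  1054 / 1000 <= y -> 339 / 100 <= (a + b) * lam S C + 24 / 37 * y.
Proof.
move=> hy; have : 339 / 100 - 24 / 37 * (1054 / 1000) <= (a + b) * lam S C.
  apply: (lam_bound S C a b u S2 C0 ha hb); first by clear; lra.
  by have := sqr_ge0 (S - 54 / 100); move: C0 (cos_le34 S C u); clear; lra.
by lra.
Qed.

Lemma wide_y3 S C a b (u : S ^+ 2 + C ^+ 2 = 1) (S2 : 1 / 2 <= S) (C0 : S <= C)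
  (ha : 1 <= 2 * S * C * a) (hb : 1 <= 2 * S * C * b) y :
  606 / 1000 <= S -> 25 / 24 <= y ->
  339 / 100 <= (a + b) * lam S C + 24 / 37 * y.
Proof.
move=> hS hy; have : 339 / 100 - 24 / 37 * (25 / 24) <= (a + b) * lam S C.
  by apply: (lam_bound S C a b u S2 C0 ha hb); move: hS S2 C0; clear; [lra | nra].
by lra.
Qed.

(** The hypothesis on [a] separates A from the unit disc around B in the threshold direction (7/25,
    24/25). It pushes [a] well above 1, which makes up for y >= 1 only. *)
Lemma wide_y4 S C a b (u : S ^+ 2 + C ^+ 2 = 1) (S2 : 1 / 2 <= S) (C0 : S <= C)
  (ha : 1 <= 2 * S * C * a) (hb : 1 <= 2 * S * C * b) y :
  606 / 1000 <= S <= 63 / 100 -> 1 <= y -> 25 <= a * (7 * S + 24 * C) ->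
  339 / 100 <= (a + b) * lam S C + 24 / 37 * y.
Proof.
move=> hS hy hA; have Ch := cos_le34 S C u.
have [SC _ a1 b1 l1] := wide_facts S C a b u S2 C0 ha hb.
have a2 : 107 / 100 <= a.
  have h1 : a * (7 * S + 24 * C) <= a * (7 * S + 24 * (5 / 4 - 3 / 4 * S)).
    by apply: ler_wpM2l; [exact: le_trans a1 | move: Ch; clear; lra].
  have h2 : a * (7 * S + 24 * (5 / 4 - 3 / 4 * S)) <= a * (23335 / 1000).
    by apply: ler_wpM2l; [exact: le_trans a1 | move: hS; clear; lra].
  by move: hA h1 h2; clear; lra.
have b2 : 102 / 100 <= b.
  have h : 2 * S * C <= 98 / 100.
    have : S * C <= S * (5 / 4 - 3 / 4 * S) by apply: ler_wpM2l => //; lra.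
    by move: hS; clear; nra.
  have : 2 * S * C * b <= 98 / 100 * b by apply: ler_wpM2r => //; exact: le_trans b1.
  by move: hb; clear; lra.
have l2 : 1315 / 1000 <= lam S C by rewrite /lam; move: hS Ch; clear; lra.
have h : 209 / 100 * (1315 / 1000) <= (a + b) * lam S C.
  by apply: ler_pM; last exact: l2; move: a2 b2; clear; lra.
by move: h hy; clear; lra.
Qed.

Lemma wide_b_poly S C : S ^+ 2 + C ^+ 2 = 1 -> 1 / 2 <= S <= 63 / 100 -> S <= C ->
  339 / 50 * (S * C) <= (1 + 2 * (S * C * (1897 / 1000 * (C - S / 3)))) * (1 + S).
Proof.
move=> u hS SC; have Ch := cos_le34 S C u.
have C2 : C ^+ 2 = 1 - S ^+ 2 by lra.
(* Eliminating C^2 makes the inequality affine in C, so that the tangent bound applies once the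
   coefficient [k] is known to be nonnegative. *)
have E : S * C * (1897 / 1000 * (C - S / 3)) =
   1897 / 1000 * (S * (1 - S ^+ 2)) - 1897 / 3000 * (S ^+ 2 * C).
  by rewrite -C2; field.
rewrite {}E; set k := 339 / 50 * S + 1897 / 1500 * (S ^+ 2 * (1 + S)).
have k0 : 0 <= k.
  have : 0 <= S ^+ 2 * (1 + S) by apply: mulr_ge0; rewrite ?sqr_ge0 //; lra.
  by rewrite /k; lra.
have h3 : C * k <= (5 / 4 - 3 / 4 * S) * k by apply: ler_wpM2r.
suff : (5 / 4 - 3 / 4 * S) * k <= (1 + 1897 / 500 * (S * (1 - S ^+ 2))) * (1 + S).
  by move: h3; rewrite /k; lra.
rewrite /k {C u SC Ch C2 k k0 h3}.
have h1 : 0 <= (63 / 100 - S) * (S - 27 / 100) ^+ 2 by rewrite mulr_ge0 ?sqr_ge0; lra.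
have h2 : 0 <= (63 / 100 - S) * S ^+ 3 by rewrite mulr_ge0 ?exprn_ge0; lra.
by have := sqr_ge0 (63 / 100 - S); lra.
Qed.

(** In this range the bound on b is better than the generic 1 / (2 S C), and the gain makes the
    direction (1, 0) sufficient. *)
Lemma wide_b S C a b (u : S ^+ 2 + C ^+ 2 = 1) (S2 : 1 / 2 <= S) (C0 : S <= C)
  (ha : 1 <= 2 * S * C * a) (hb : 1 <= 2 * S * C * b) :
  1 / 2 <= S <= 63 / 100 -> 1897 / 1000 * (C - S / 3) <= b ->
  339 / 100 <= (a + b) * (1 + S).
Proof.
move=> hS hB; have Ch := cos_le34 S C u; have [SC _ a1 b1 l1] := wide_facts S C a b u S2 C0 ha hb.
suff key : 339 / 50 * (S * C) <= (1 + 2 * (S * C) * b) * (1 + S).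
  suff : 339 / 50 * (S * C) <= (a + b) * (1 + S) * 2 * (S * C).
    by rewrite ler_pM2r //; clear; lra.
  have : 0 <= (2 * S * C * a - 1) * (1 + S).
    by apply: mulr_ge0; [rewrite subr_ge0 | move: S2; clear; lra].
  by move: key; clear; lra.
have h1 : S * C * (1897 / 1000 * (C - S / 3)) <= S * C * b.
  by apply: ler_wpM2l => //; exact: ltW.
have h2 : (1 + 2 * (S * C * (1897 / 1000 * (C - S / 3)))) * (1 + S) <=
    (1 + 2 * (S * C) * b) * (1 + S).
  apply: ler_wpM2r; first by move: S2; clear; lra.
  by move: h1; clear; lra.
apply: le_trans h2.
exact: wide_b_poly.
Qed.

(** For a separating normal with q <= 0. As a >= 1 / S and b >= 1, the right side is at least 2 + S
    + 1 / S >= 4. *)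
Lemma steep_bound S C a b (u : S ^+ 2 + C ^+ 2 = 1) (S2 : 1 / 2 <= S) (C0 : S <= C)
  (ha : 1 <= 2 * S * C * a) (hb : 1 <= 2 * S * C * b) :
  1 <= a * S -> 339 / 100 <= (a + b) * (1 + S).
Proof.
move=> hA; have [SC _ a1 b1 l1] := wide_facts S C a b u S2 C0 ha hb.
have : 0 <= (a * S - 1) + (b - 1) * S by rewrite addr_ge0 ?mulr_ge0; lra.
nra.
Qed.

(** For a separating normal with p < 0: the bounds a >= 1 / C and b >= 1 / (2 S C) combine. *)
Lemma tilted_bound S C a b (u : S ^+ 2 + C ^+ 2 = 1) (S2 : 1 / 2 <= S) (C0 : S <= C)
  (ha : 1 <= 2 * S * C * a) (hb : 1 <= 2 * S * C * b) :
  1 <= a * C -> 339 / 100 <= (a + b) * (1 + S).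
Proof.
move=> hA; have [SC _ a1 b1 l1] := wide_facts S C a b u S2 C0 ha hb; have Ch := cos_le34 S C u.
have C1 : 0 < C by lra.
suff : 339 / 50 * (S * C) <= (a + b) * (1 + S) * 2 * (S * C).
  by rewrite ler_pM2r // => H; lra.
have h1 : 0 <= (2 * S * C * b - 1) * (1 + S) by apply: mulr_ge0; lra.
have h2 : 0 <= (a * C - 1) * (S * (1 + S)) by apply: mulr_ge0; [lra|apply: mulr_ge0; lra].
have h3 : S * C <= S * (5 / 4 - 3 / 4 * S) by apply: ler_wpM2l; lra.
have h4 : 339 / 50 * (S * (5 / 4 - 3 / 4 * S)) <= (1 + 2 * S) * (1 + S) by nra.
by lra.
Qed.

(* With S = sin θ and C = cos θ, S (3 - 4 S^2) = sin 3θ and C (4 S^2 - 1) = - cos 3θ: the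
   minimum over θ of 4 cos θ / sin 3θ is attained at tan θ = r / w. *)
Lemma kite_min S C r w : r ^+ 2 = 3 -> w ^+ 2 = 3 + 2 * r -> 0 < w ->
  S ^+ 2 + C ^+ 2 = 1 -> 0 < S -> 0 < C ->
  4 / 3 * w * (S * (3 - 4 * S ^+ 2)) <= 4 * C /\
  (4 * C <= 4 / 3 * w * (S * (3 - 4 * S ^+ 2)) -> w * S = r * C).
Proof.
move=> r2 w2 w0 u S0 C0.
(* Made homogeneous by S^2 + C^2 = 1, the difference is a cubic form with a double root at S : C = r
   : w, which gives the equality case. *)
have E : w * (3 * C - w * (S * (3 - 4 * S ^+ 2))) = (w * S - r * C) ^+ 2 * (S + w * C).
  have -> : 3 * C - w * (S * (3 - 4 * S ^+ 2)) =
     3 * C * (S ^+ 2 + C ^+ 2) - w * S * (3 * (S ^+ 2 + C ^+ 2) - 4 * S ^+ 2).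
    by rewrite u; ring.
  transitivity (w ^+ 2 * S ^+ 3 + w * 3 * S ^+ 2 * C - 3 * w ^+ 2 * (S * C ^+ 2)
     + 3 * w * C ^+ 3); first by ring.
  transitivity (w ^+ 2 * S ^+ 3 + w * (w ^+ 2 - 2 * r) * S ^+ 2 * C
     + (r ^+ 2 - 2 * w ^+ 2 * r) * (S * C ^+ 2) + r ^+ 2 * w * C ^+ 3); last by ring.
  have -> : r ^+ 2 - 2 * w ^+ 2 * r = - 3 * w ^+ 2 by rewrite w2; lra.
  have -> : w ^+ 2 - 2 * r = 3 by lra.
  by rewrite r2; ring.
have wC : 0 < S + w * C by rewrite addr_gt0 ?mulr_gt0.
split.
  have : 0 <= w * (3 * C - w * (S * (3 - 4 * S ^+ 2))).
    by rewrite E mulr_ge0 ?sqr_ge0 ?ltW.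
  by rewrite pmulr_rge0 //; lra.
move=> le4; have : (w * S - r * C) ^+ 2 * (S + w * C) <= 0.
  by rewrite -E pmulr_rle0 //; lra.
rewrite pmulr_lle0 // => sq0; apply/eqP; rewrite -subr_eq0 -sqrf_eq0.
by rewrite eq_le sq0 sqr_ge0.
Qed.

(* The graph of z |-> 1 / z lies above its tangent at [z0]. *)
Lemma tangent_inv a z z0 : 0 < z -> 0 < z0 -> 1 <= a * z -> 2 / z0 - z / z0 ^+ 2 <= a.
Proof.
move=> zp z0p az; have z2 : 0 < z0 ^+ 2 by rewrite exprn_gt0.
rewrite -(ler_pM2r z2); have -> : (2 / z0 - z / z0 ^+ 2) * z0 ^+ 2 = 2 * z0 - z.
  by field; rewrite gt_eqF.
rewrite -(ler_pM2r zp).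
have : z0 ^+ 2 <= z0 ^+ 2 * (a * z) by rewrite ler_peMr // ltW.
by have := sqr_ge0 (z - z0); lra.
Qed.

Lemma tilt_unit S C : S ^+ 2 + C ^+ 2 = 1 ->
  (C * (4 * S ^+ 2 - 1)) ^+ 2 + (S * (3 - 4 * S ^+ 2)) ^+ 2 = 1.
Proof.
move=> u; have C2 : C ^+ 2 = 1 - S ^+ 2 by lra.
by rewrite exprMn C2; ring.
Qed.

(** The slope condition of [arc_linear] as [kite_side] needs it. In terms of m it is a polynomial
    inequality, which already fails at S^2 = 3/8; this is why the extremal argument stops at S =
    606/1000. *)
Lemma tilt_slope S C k m : k = 4 * S ^+ 2 - 1 -> m = 3 - 4 * S ^+ 2 ->
  S ^+ 2 + C ^+ 2 = 1 -> 1 / 2 < S <= 606 / 1000 -> 0 < C ->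
  (1 / (4 * S ^+ 2) + k / (S * m) ^+ 2) * (C * k) < 1 / (4 * (S * C)) * (S * m).
Proof.
move=> Ek Em u hS C0.
have S2 : 1 / 4 < S ^+ 2 <= 37 / 100 by apply/andP; split; nra.
have m0 : 0 < m by lra.
have k0 : 0 < k by lra.
have S0 : 0 < S by lra.
have -> : (1 / (4 * S ^+ 2) + k / (S * m) ^+ 2) * (C * k) =
  (C ^+ 2 * k * (m ^+ 2 + 4 * k)) / (4 * C * S ^+ 2 * m ^+ 2).
  by field; rewrite !gt_eqF.
have -> : 1 / (4 * (S * C)) * (S * m) = (S ^+ 2 * m ^+ 3) / (4 * C * S ^+ 2 * m ^+ 2).
  by field; rewrite !gt_eqF.
rewrite ltr_pM2r; last by rewrite invr_gt0 !mulr_gt0 ?exprn_gt0.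
have [v1 [v2 v3]] : C ^+ 2 = (1 + m) / 4 /\ S ^+ 2 = (3 - m) / 4 /\ k = 2 - m.
  by split; [|split]; lra.
have m1 : 152 / 100 <= m <= 2 by lra.
rewrite {}v1 {}v2 {}v3; move: m m1 {S2 m0 k0 Em Ek} => n n1.
have h1 : 0 <= (n - 152 / 100) * (2 - n) by apply: mulr_ge0; lra.
have h2 : 0 <= n * ((n - 152 / 100) * (2 - n)) by apply: mulr_ge0; lra.
by have := sqr_ge0 (n - 152 / 100); lra.
Qed.

(* [(- p, q)] is a unit vector separating the side AD from the unit disc around B = 0. *)
Lemma kite_side S C a b x y p q L r w : r ^+ 2 = 3 -> w ^+ 2 = 3 + 2 * r -> 0 < w ->
  S ^+ 2 + C ^+ 2 = 1 -> 1 / 2 < S <= 606 / 1000 -> 0 < C ->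
  1 <= 2 * S * C * a -> 1 <= 2 * S * C * b ->
  p ^+ 2 + q ^+ 2 = 1 -> 1 <= a * (S * p + C * q) -> 1 <= - p * x + q * y ->
  0 <= x -> 0 <= p -> 0 < q ->
  2 * C * (C * (a + b) + y * (4 * S ^+ 2 - 1)) <= L ->
  4 / 3 * w <= L /\
  (L <= 4 / 3 * w -> [/\ w * S = r * C, 2 * S * C * a = 1, 2 * S * C * b = 1, x = 0 &
     y * (S * (3 - 4 * S ^+ 2)) = 1]).
Proof.
move=> r2 w2 w0 u hS C0 ha hb pq hA hD x0 p0 q0.
have S0 : 0 < S by lra.
have [k [m [Ek Em]]] : exists k m, k = 4 * S ^+ 2 - 1 /\ m = 3 - 4 * S ^+ 2.
  by exists (4 * S ^+ 2 - 1), (3 - 4 * S ^+ 2).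
have [kmin keq] := kite_min S C r w r2 w2 w0 u S0 C0.
have U := tilt_unit S C u; rewrite -Ek -Em in U kmin keq *; move=> hL.
have S2 : 1 / 4 < S ^+ 2 <= 37 / 100.
  by move: hS; clear => hS; apply/andP; split; nra.
have m0 : 0 < m by move: Em S2; clear; lra.
have k0 : 0 < k by move: Ek S2; clear; lra.
have Sm : 0 < S * m by rewrite mulr_gt0.
have Ck : 0 < C * k by rewrite mulr_gt0.
have mk : m + k = 2 by rewrite Em Ek; ring.
have yq : 1 <= y * q.
  have : 0 <= p * x by apply: mulr_ge0.
  by move: hD; clear; lra.
have y0 : 0 < y by rewrite -(pmulr_lgt0 _ q0); exact: lt_le_trans yq.
have SC : 0 < 2 * S * C by rewrite !mulr_gt0.
have a0 : 0 < a by rewrite -(pmulr_rgt0 _ SC); exact: lt_le_trans ha.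
(* [(C * k, S * m)] is the value of [(p, q)] for the extremal AD. If [p] is at least that, then y >=
   1 / (S m), and every estimate is sharp only for the kite. *)
case: (lerP (C * k) p) => pp.
- have qq : q <= S * m.
    apply: sqr_le_cancel; first exact: ltW.
    have : (C * k) ^+ 2 <= p ^+ 2 by apply: sqr_le => //; exact: ltW.
    by move: pq U; clear; lra.
  have C2 : 0 <= 2 * C by rewrite mulr_ge0 // ltW.
  have h1 : 0 <= 2 * C * (m * (S * (C * (a + b)) - 1)).
    apply: mulr_ge0 => //; apply: mulr_ge0; first exact: ltW.
    by move: ha hb; clear; lra.
  have yS : 1 <= y * (S * m) by apply: le_trans yq _; rewrite ler_wpM2l // ltW.
  have h2 : 0 <= 2 * C * (k * (y * (S * m) - 1)).
    by apply: mulr_ge0 => //; rewrite mulr_ge0 ?subr_ge0 // ltW.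
  have h3 : 2 * C * (C * (a + b) + y * k) * (S * m) <= L * (S * m).
    by rewrite ler_wpM2r ?(ltW Sm).
  have E : 2 * C * (C * (a + b) + y * k) * (S * m) =
    2 * C * (m + k) + 2 * C * (m * (S * (C * (a + b)) - 1)) + 2 * C * (k * (y * (S * m) - 1)).
    by ring.
  rewrite E mk in h3; split.
    by rewrite -(ler_pM2r Sm); move: kmin h1 h2 h3; clear; lra.
  move=> hc; have h4 : L * (S * m) <= 4 / 3 * w * (S * m) by rewrite ler_wpM2r ?(ltW Sm).
  have e1 : 2 * C * (m * (S * (C * (a + b)) - 1)) = 0.
    by move: kmin h1 h2 h3 h4; clear; lra.
  have e2 : 2 * C * (k * (y * (S * m) - 1)) = 0.
    by move: kmin h1 h2 h3 h4; clear; lra.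
  have f1 : S * (C * (a + b)) = 1.
    apply/eqP; rewrite -subr_eq0; move/eqP: e1.
    by rewrite !mulf_eq0 (gt_eqF m0) (gt_eqF C0) pnatr_eq0 /= => /eqP ->.
  have f2 : y * (S * m) = 1.
    apply/eqP; rewrite -subr_eq0; move/eqP: e2.
    by rewrite !mulf_eq0 (gt_eqF k0) (gt_eqF C0) pnatr_eq0 /= => /eqP ->.
  split=> //.
  - by apply: keq; move: h1 h2 h3 h4; clear; lra.
  - by move: f1 ha hb; clear; lra.
  - by move: f1 ha hb; clear; lra.
  have yq' : y * q <= y * (S * m) by rewrite ler_wpM2l // ltW.
  have px : 0 <= p * x by apply: mulr_ge0.
  have /eqP : p * x = 0 by move: yq' f2 hD px; clear; lra.
  by rewrite mulf_eq0 gt_eqF ?(lt_le_trans Ck) // => /eqP.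
- suff lt : 4 / 3 * w < L by split; [exact: ltW | rewrite leNgt lt].
  rewrite -(ltr_pM2r Sm); apply: le_lt_trans kmin _.
  set z := S * p + C * q in hA.
  have z0 : 0 < z by rewrite -(pmulr_rgt0 _ a0); exact: lt_le_trans hA.
  (* The tangency points are the values at the extremal direction, where S p + C q = S C (k + m) = 2
     S C. The two tangents add up to a linear form in (p, q), to which [arc_linear] applies with
     strict inequality. *)
  have ta := tangent_inv a z (2 * S * C) z0 SC hA.
  have ty := tangent_inv y q (S * m) q0 Sm yq.
  have al0 : 0 < 1 / (4 * (S * C)) by rewrite divr_gt0 ?mulr_gt0.
  have ga0 : 0 <= 1 / (4 * S ^+ 2) + k / (S * m) ^+ 2.
    by rewrite addr_ge0 ?divr_ge0 ?mulr_ge0 ?exprn_ge0 ?ltW.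
  have slope := tilt_slope S C k m Ek Em u hS C0.
  have arc := arc_linear p q (C * k) (S * m) _ _ pq U Sm (ltW Ck) al0 ga0 pp slope.
  have Ca : C * (2 / (2 * S * C) - z / (2 * S * C) ^+ 2) <= C * a
    by rewrite ler_wpM2l ?(ltW C0).
  have ky : k * (2 / (S * m) - q / (S * m) ^+ 2) <= k * y
    by rewrite ler_wpM2l ?(ltW k0).
  have E1 : C * (2 / (2 * S * C) - z / (2 * S * C) ^+ 2) + k * (2 / (S * m) - q / (S * m) ^+ 2)
   = 1 / S + 2 * k / (S * m) - (1 / (4 * (S * C)) * p + (1 / (4 * S ^+ 2) + k / (S * m) ^+ 2) * q).
    by rewrite /z; field; rewrite !gt_eqF.
  have E2 : 1 / (4 * (S * C)) * (C * k) + (1 / (4 * S ^+ 2) + k / (S * m) ^+ 2) * (S * m) =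
   1 / (2 * S) + k / (S * m).
    transitivity ((m + k) / (4 * S) + k / (S * m)); first by field; rewrite !gt_eqF.
    by rewrite mk; field; rewrite !gt_eqF.
  have S12 : 1 / S = 1 / (2 * S) + 1 / (2 * S) by field; rewrite gt_eqF.
  have key : 1 / (2 * S) + k / (S * m) < C * a + k * y.
    by move: Ca ky E1 E2 arc S12; clear; lra.
  have Cb : 1 / (2 * S) <= C * b.
    by rewrite ler_pdivrMr ?mulr_gt0 //; move: hb; clear; lra.
  have key2 : 2 * C * (1 / S + k / (S * m)) < L.
    apply: lt_le_trans hL; rewrite ltr_pM2l ?mulr_gt0 //.
    by move: key Cb S12; clear; lra.
  rewrite -(ltr_pM2r Sm) in key2.
  have E3 : 2 * C * (1 / S + k / (S * m)) * (S * m) = 4 * C.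
    transitivity (2 * C * (m + k)); first by field; rewrite !gt_eqF.
    by rewrite mk; ring.
  by rewrite E3 in key2.
Qed.

(** The tilt of AD is cut at the rational unit vector (7/25, 24/25): on this side y >= 25/24
    ([wide_y3]), on that of [wide_tilt] the leg a is long ([wide_y4]). *)
Lemma narrow_tilt p q : p ^+ 2 + q ^+ 2 = 1 -> 0 <= p -> 0 < q -> 7 * q <= 24 * p ->
  q <= 24 / 25.
Proof.
move=> u p0 q0 h; apply: sqr_le_cancel; first by lra.
have : (7 * q) ^+ 2 <= (24 * p) ^+ 2 by apply: sqr_le; lra.
by rewrite !exprMn; lra.
Qed.

Lemma wide_tilt p q : p ^+ 2 + q ^+ 2 = 1 -> 0 <= p -> 24 * p < 7 * q -> p < 7 / 25.
Proof.
move=> u p0 h; rewrite ltNge; apply/negP => h2.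
have : (24 * p) ^+ 2 < (7 * q) ^+ 2 by apply: sqr_lt; lra.
have : (7 / 25) ^+ 2 <= p ^+ 2 by apply: sqr_le; lra.
by rewrite !exprMn; lra.
Qed.

(** The last hypothesis leaves the projection direction free, so that each range of angles uses its
    own: (1, 0), (35/37, 12/37) or the extremal one. *)
Lemma kite_side_all S C a b x y p q L r w : r ^+ 2 = 3 -> w ^+ 2 = 3 + 2 * r -> 0 < w ->
  S ^+ 2 + C ^+ 2 = 1 -> 1 / 2 < S -> S <= C ->
  1 <= 2 * S * C * a -> 1 <= 2 * S * C * b ->
  p ^+ 2 + q ^+ 2 = 1 -> 1 <= a * (S * p + C * q) -> 1 <= - p * x + q * y -> 0 <= x ->
  (forall k1 k2, k1 ^+ 2 + k2 ^+ 2 = 1 ->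
     (a + b) * (1 + S * k1 - C * k2) + 2 * y * k2 <= L) ->
  339 / 100 <= L \/ 4 / 3 * w <= L /\
  (L <= 4 / 3 * w -> [/\ w * S = r * C, 2 * S * C * a = 1, 2 * S * C * b = 1, x = 0 &
     y * (S * (3 - 4 * S ^+ 2)) = 1]).
Proof.
move=> r2 w2 w0 u S2 SC ha hb pq hA hD x0 hL.
have S2' := ltW S2.
have [SCp _ a1 b1 _] := wide_facts S C a b u S2' SC ha hb.
have S0 : 0 < S by apply: lt_trans S2; rewrite divr_gt0.
have C0 : 0 < C := lt_le_trans S0 SC.
have a0 : 0 < a := lt_le_trans ltr01 a1.
have one : 1 ^+ 2 + 0 ^+ 2 = 1 :> R by ring.
have k37 : (35 / 37) ^+ 2 + (12 / 37) ^+ 2 = 1 :> R by field.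
have L1 : (a + b) * (1 + S) <= L by have := hL _ _ one; rewrite !mulr0 mulr1 subr0 addr0.
have L2 y' : y' <= y -> (a + b) * lam S C + 24 / 37 * y' <= L.
  by move=> yy; apply: le_trans (hL _ _ k37); rewrite /lam {hL hD}; lra.
case: (lerP q 0) => q0.
  left; apply: le_trans L1; apply: (steep_bound S C) => //.
  have p1 : p <= 1 by apply: sqr_le_cancel => //; have := sqr_ge0 q; rewrite expr1n -pq; lra.
  have h1 : a * (C * q) <= 0 by rewrite pmulr_rle0 // pmulr_rle0.
  have h2 : a * (S * p) <= a * S by rewrite ler_pM2l // ler_piMr ?(ltW S0).
  by move: hA h1 h2; rewrite mulrDr; lra.
have q1 : q <= 1 by apply: sqr_le_cancel => //; have := sqr_ge0 p; rewrite expr1n -pq; lra.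
case: (ltrP p 0) => p0.
  left; apply: le_trans L1; apply: (tilted_bound S C) => //.
  have h1 : a * (S * p) <= 0 by rewrite pmulr_rle0 // pmulr_rle0 // ltW.
  have h2 : a * (C * q) <= a * C by rewrite ler_pM2l // ler_piMr ?(ltW C0).
  by move: hA h1 h2; rewrite mulrDr; lra.
have yq : 1 <= y * q.
  have px : 0 <= p * x by exact: mulr_ge0.
  by move: hD; lra.
have y0 : 0 < y by rewrite -(pmulr_lgt0 _ q0); exact: lt_le_trans yq.
have y1 : 1 <= y by apply: le_trans yq _; rewrite ler_piMr // ltW.
case: (lerP (63 / 100) S) => S63.
  by left; apply: le_trans (L2 _ (lexx y)); apply: wide_y1.
case: (lerP (606 / 1000) S) => S606.
  left; apply: le_trans (L2 _ (lexx y)).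
  case: (lerP (7 * q) (24 * p)) => pq7.
    apply: wide_y3 => //.
    have q2 := narrow_tilt p q pq p0 q0 pq7.
    have : y * q <= y * (24 / 25) by rewrite ler_pM2l.
    by lra.
  apply: wide_y4 => //; first by rewrite S606 ltW.
  have p7 := wide_tilt p q pq p0 pq7.
  have e7 : (7 / 25) ^+ 2 + (24 / 25) ^+ 2 = 1 :> R by field.
  have pos24 : 0 < 24 / 25 :> R by rewrite divr_gt0.
  have pos7 : 0 <= 7 / 25 :> R by rewrite divr_ge0.
  have sl : C * (7 / 25) < S * (24 / 25).
    by move: (cos_le34 S C u) S606; clear; lra.
  have := arc_linear p q (7 / 25) (24 / 25) S C pq e7 pos24 pos7 S0 (ltW C0) p7 sl.
  by rewrite -(ltr_pM2l a0); move: hA; clear; lra.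
right; apply: (kite_side S C a b x y p q) => //; first by rewrite S2 ltW.
have U := tilt_unit S C u; rewrite addrC in U.
have {hL} := hL _ _ U.
have C2 : C ^+ 2 = 1 - S ^+ 2 by rewrite -u; ring.
(* That is, 1 + sin θ sin 3θ + cos θ cos 3θ = 1 + cos 2θ = 2 cos^2 θ. *)
have -> : 1 + S * (S * (3 - 4 * S ^+ 2)) - C * (C * (4 * S ^+ 2 - 1)) = 2 * C ^+ 2.
  transitivity (1 + S ^+ 2 * (3 - 4 * S ^+ 2) - C ^+ 2 * (4 * S ^+ 2 - 1)); first by ring.
  by rewrite C2; ring.
move=> H; apply: le_trans H; rewrite le_eqVlt; apply/orP; left; apply/eqP; ring.
Qed.

(* [(x1, y1)] is the point of AD equidistant from B and C. *)
Lemma bent_side S C a b y x1 y1 L :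
  S ^+ 2 + C ^+ 2 = 1 -> 1 / 2 < S -> S <= C ->
  1 <= 2 * S * C * a -> 1 <= 2 * S * C * b ->
  x1 <= 0 -> 0 < y1 -> 1 <= x1 ^+ 2 + y1 ^+ 2 -> b = 2 * (S * x1 + C * y1) ->
  x1 ^+ 2 + y1 ^+ 2 <= y * y1 ->
  (a + b) * (1 + S) <= L -> (a + b) * lam S C + 24 / 37 * y <= L ->
  339 / 100 <= L.
Proof.
have n1 : (1054 / 1000) ^+ 2 <= 10 / 9 :> R by lra.
have n2 : (1897 / 2000) ^+ 2 <= 9 / 10 :> R by lra.
move=> u S2 SC ha hb x10 y10 rho bE yy L1 L2.
have S2' := ltW S2.
have y1y : 1 <= y.
  rewrite leNgt; apply/negP => ylt.
  have h1 : y * y1 < 1 * y1 by rewrite ltr_pM2r.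
  have h2 : y1 < 1.
    rewrite ltNge; apply/negP => h2; have : y1 <= y1 ^+ 2 by rewrite expr2 ler_peMl // ltW.
    by move: yy h1 h2 (sqr_ge0 x1); clear; lra.
  by move: yy h1 h2 rho; clear; lra.
case: (lerP (63 / 100) S) => S63.
  by apply: le_trans L2; apply: wide_y1.
(* Either the equidistant point lies well to the left, and D must be as high as sqrt (10/9), or it
   lies nearly above B, and b, which it determines, is long. *)
case: (lerP y1 (- (3 * x1))) => hx.
  apply: le_trans L2; apply: wide_y2 => //.
  apply: sqr_le_cancel; first exact: le_trans y1y.
  have h1 : (10 / 9) * y1 ^+ 2 <= x1 ^+ 2 + y1 ^+ 2.
    have : y1 ^+ 2 <= (- (3 * x1)) ^+ 2 by apply: sqr_le => //; exact: ltW.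
    by rewrite sqrrN exprMn; clear; lra.
  have h2 : (x1 ^+ 2 + y1 ^+ 2) ^+ 2 <= (y * y1) ^+ 2.
    by apply: sqr_le => //; apply: le_trans rho.
  have h3 : x1 ^+ 2 + y1 ^+ 2 <= (x1 ^+ 2 + y1 ^+ 2) ^+ 2.
    by rewrite [leRHS]expr2 ler_peMl //; apply: le_trans rho.
  have h4 : 10 / 9 * y1 ^+ 2 <= y ^+ 2 * y1 ^+ 2.
    by rewrite -exprMn; move: h1 h2 h3; clear; lra.
  move: h4; rewrite ler_pM2r ?exprn_gt0 // => h4.
  exact: le_trans n1 h4.
have hS : 1 / 2 <= S <= 63 / 100 by rewrite S2' ltW.
apply: le_trans L1; apply: (wide_b S C a b u S2' SC ha hb hS).
have h0 : 9 / 10 <= y1 ^+ 2.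
  have : (- (3 * x1)) ^+ 2 <= y1 ^+ 2 by apply: sqr_le; [move: x10; clear; lra | exact: ltW].
  by rewrite sqrrN exprMn; move: rho; clear; lra.
have h1 : 1897 / 2000 <= y1.
  by apply: sqr_le_cancel; [exact: ltW | exact: le_trans n2 h0].
have CS : 0 <= C - S / 3 by move: SC S2; clear; lra.
have h2 : 1897 / 2000 * (C - S / 3) <= y1 * (C - S / 3) by rewrite ler_wpM2r.
have S0 : 0 <= S by apply: le_trans S2'; rewrite divr_ge0.
have h3 : S * (- x1) <= S * (y1 / 3) by rewrite ler_wpM2l //; move: hx; clear; lra.
by rewrite bE; move: h2 h3; clear; lra.
Qed.

End Scalar.

(** * Segments and rigid motions of the plane *)

Section Plane.
Context {R : realType}.
Implicit Types (x y z w : 'rV[R]_2) (t e p q h k : R).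

Definition lerp t x y : 'rV[R]_2 := (1 - t) *: x + t *: y.

Lemma lerpE t x y j : lerp t x y 0 j = (1 - t) * x 0 j + t * y 0 j.
Proof. by rewrite !mxE. Qed.

Lemma lerp0 x y : lerp 0 x y = x.
Proof. by rewrite /lerp subr0 scale1r scale0r addr0. Qed.

Lemma lerp1 x y : lerp 1 x y = y.
Proof. by rewrite /lerp subrr scale0r scale1r add0r. Qed.

Lemma lerpC t x y : lerp t x y = lerp (1 - t) y x.
Proof. by rewrite /lerp addrC; congr (_ *: _ + _); ring. Qed.

Lemma vec2_0 (a b : R) : vec2 a b 0 0 = a.
Proof. by rewrite mxE. Qed.

Lemma vec2_1 (a b : R) : vec2 a b 0 1 = b.
Proof. by rewrite mxE. Qed.

Definition vec2E := (vec2_0, vec2_1).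

Lemma vec2_eta x : x = vec2 (x 0 0) (x 0 1).
Proof.
apply/rowP => j; rewrite mxE; case: j => [[|[|j]] //= ij];
by congr (x _ _); apply/val_inj.
Qed.

Lemma lerp_vec2 t (a b a' b' : R) : lerp t (vec2 a b) (vec2 a' b') =
  vec2 ((1 - t) * a + t * a') ((1 - t) * b + t * b').
Proof. by rewrite [LHS]vec2_eta !lerpE !vec2E. Qed.

Lemma dist_sq x y :
  dist x y ^+ 2 = (x 0 0 - y 0 0) ^+ 2 + (x 0 1 - y 0 1) ^+ 2.
Proof. by rewrite distE sqr_sqrtr // addr_ge0 ?sqr_ge0. Qed.

Lemma dist_vec2 (a b a' b' : R) :
  dist (vec2 a b) (vec2 a' b') ^+ 2 = (a - a') ^+ 2 + (b - b') ^+ 2.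
Proof. by rewrite dist_sq !vec2E. Qed.

Lemma dist_eq0 x y : dist x y = 0 -> x = y.
Proof.
move=> d0; have := dist_sq x y; rewrite d0 expr0n /= => /esym /eqP.
rewrite paddr_eq0 ?sqr_ge0 // !sqrf_eq0 !subr_eq0 => /andP[/eqP e0 /eqP e1].
by rewrite (vec2_eta x) (vec2_eta y) e0 e1.
Qed.

Lemma le_dist (r : R) x y : r ^+ 2 <= dist x y ^+ 2 -> r <= dist x y.
Proof.
move=> h; case: (lerP r 0) => [r0|r0]; first exact: le_trans r0 (dist_ge0 _ _).
by rewrite -(ler_pXn2r (n := 2)) ?nnegrE ?dist_ge0 ?(ltW r0).
Qed.

Lemma dist_ge1 x y : (1 <= dist x y) = (1 <= dist x y ^+ 2).
Proof. by rewrite -[X in _ = (X <= _)](expr1n _ 2) ler_pXn2r ?nnegrE ?dist_ge0 //. Qed.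

Lemma dist_linear (c s : R) x y : c ^+ 2 + s ^+ 2 = 1 ->
  c * (x 0 0 - y 0 0) + s * (x 0 1 - y 0 1) <= dist x y.
Proof.
move=> cs; apply: le_dist; rewrite dist_sq.
set u := _ - _; set v := _ - _.
have -> : u ^+ 2 + v ^+ 2 = (c ^+ 2 + s ^+ 2) * (u ^+ 2 + v ^+ 2).
  by rewrite cs mul1r.
by have := sqr_ge0 (c * v - s * u); nra.
Qed.

Lemma dist_lerp_cat x y t : 0 <= t <= 1 ->
  dist x (lerp t x y) + dist (lerp t x y) y = dist x y.
Proof.
move=> /andP[t0 t1].
have -> : dist x (lerp t x y) = t * dist x y.
  apply/eqP; rewrite -(@eqrXn2 _ 2) ?dist_ge0 ?mulr_ge0 ?dist_ge0 //.
  by rewrite exprMn !dist_sq !lerpE; apply/eqP; ring.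
have -> : dist (lerp t x y) y = (1 - t) * dist x y.
  apply/eqP; rewrite -(@eqrXn2 _ 2) ?dist_ge0 ?mulr_ge0 ?dist_ge0 ?subr_ge0 //.
  by rewrite exprMn !dist_sq !lerpE; apply/eqP; ring.
by ring.
Qed.

Lemma dist_lerp_sq t x y z : dist z (lerp t x y) ^+ 2 =
  (1 - t) * dist z x ^+ 2 + t * dist z y ^+ 2 - t * (1 - t) * dist x y ^+ 2.
Proof. by rewrite !dist_sq !lerpE; ring. Qed.

Definition away x y z : Prop := forall t, 0 <= t <= 1 -> 1 <= dist (lerp t x y) z.

Definition covers x y z w : Prop := forall t, 0 <= t <= 1 ->
  1 <= dist (lerp t x y) z \/ 1 <= dist (lerp t x y) w.

Lemma awayC x y z : away x y z -> away y x z.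
Proof. by move=> h t /andP[? ?]; rewrite lerpC; apply: h; lra. Qed.

Lemma coversC x y z w : covers x y z w -> covers y x w z.
Proof.
move=> h t /andP[? ?]; rewrite lerpC.
by case: (h (1 - t)); [lra | right | left].
Qed.

Lemma covers_swap x y z w : covers x y z w -> covers x y w z.
Proof. by move=> h t /h; tauto. Qed.

Lemma away_l x y z : away x y z -> 1 <= dist x z.
Proof. by move=> /(_ 0); rewrite lerp0; apply; lra. Qed.

Lemma away_r x y z : away x y z -> 1 <= dist y z.
Proof. by move=> /(_ 1); rewrite lerp1; apply; lra. Qed.

Lemma not_awayP x y z : ~ away x y z ->
  exists2 t, 0 <= t <= 1 & dist (lerp t x y) z < 1.
Proof.
move=> /existsNP[t /not_implyP[t01 /negP]]; rewrite -ltNge => d1.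
by exists t.
Qed.

Definition quad_perimeter x y z w : R := dist x y + dist y z + dist z w + dist w x.

(** Reflections are included. The right inverse serves to carry the kite back in
    [kite_similarity]. *)
Definition rigid (g : 'rV[R]_2 -> 'rV[R]_2) : Prop :=
  [/\ forall x y, dist (g x) (g y) = dist x y,
      forall t x y, g (lerp t x y) = lerp t (g x) (g y) &
      exists g', cancel g' g].

Lemma rigid_comp f g : rigid f -> rigid g -> rigid (f \o g).
Proof.
move=> [df lf [f' f'K]] [dg lg [g' g'K]]; split=> [x y|t x y|].
- by rewrite /= df dg.
- by rewrite /= lg lf.
- by exists (g' \o f') => x /=; rewrite g'K f'K.
Qed.

Lemma rigid_away g x y z : rigid g -> away (g x) (g y) (g z) <-> away x y z.
Proof.
by case=> dg lg _; split=> h t /h; rewrite -lg dg.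
Qed.

Lemma rigid_covers g x y z w : rigid g ->
  covers (g x) (g y) (g z) (g w) <-> covers x y z w.
Proof.
by case=> dg lg _; split=> h t /h; rewrite -lg !dg.
Qed.

(** The point o goes to the origin and the direction (c, s) to the first axis; [eps = -1] adds the
    reflection in that axis. *)
Lemma rigid_motion (c s eps : R) (o : 'rV[R]_2) : c ^+ 2 + s ^+ 2 = 1 -> eps ^+ 2 = 1 ->
  rigid (fun z => vec2 (c * (z 0 0 - o 0 0) + s * (z 0 1 - o 0 1))
                          (eps * (c * (z 0 1 - o 0 1) - s * (z 0 0 - o 0 0)))).
Proof.
move=> cs ep; split=> [x y|t x y|].
- apply/eqP; rewrite -(@eqrXn2 _ 2) ?dist_ge0 // dist_vec2 dist_sq; apply/eqP.
  rewrite -[RHS]mul1r -cs.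
  transitivity ((c * (x 0 0 - y 0 0) + s * (x 0 1 - y 0 1)) ^+ 2 +
     eps ^+ 2 * (c * (x 0 1 - y 0 1) - s * (x 0 0 - y 0 0)) ^+ 2); first by ring.
  by rewrite ep; ring.
- by rewrite [RHS]vec2_eta !lerpE !vec2E; congr vec2; ring.
- exists (fun z => vec2 (o 0 0 + c * z 0 0 - s * (eps * z 0 1))
                        (o 0 1 + s * z 0 0 + c * (eps * z 0 1))) => z /=.
  rewrite [RHS]vec2_eta !vec2E; congr vec2.
    transitivity ((c ^+ 2 + s ^+ 2) * z 0 0); first by ring.
    by rewrite cs mul1r.
  transitivity (eps ^+ 2 * (c ^+ 2 + s ^+ 2) * z 0 1); first by ring.
  by rewrite cs ep !mul1r.
Qed.

Lemma frame_axis x y z : exists2 g, rigid g &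
  [/\ g x = vec2 0 0, g y = vec2 (dist x y) 0 & 0 <= g z 0 1].
Proof.
pose d := dist x y.
have [c [s [cs [ec es]]]] : exists c s, c ^+ 2 + s ^+ 2 = 1 /\
    (y 0 0 - x 0 0 = d * c /\ y 0 1 - x 0 1 = d * s).
  have [d0|d0] := eqVneq d 0.
    exists 1, 0; rewrite d0 !mul0r; split; first by ring.
    by rewrite (dist_eq0 _ _ d0) !subrr.
  exists ((y 0 0 - x 0 0) / d), ((y 0 1 - x 0 1) / d); split.
    rewrite !expr_div_n -mulrDl; have <- : d ^+ 2 = (y 0 0 - x 0 0) ^+ 2 +
      (y 0 1 - x 0 1) ^+ 2 by rewrite /d dist_sq; ring.
    by rewrite divff // expf_neq0.
  by split; field.
pose v := c * (z 0 1 - x 0 1) - s * (z 0 0 - x 0 0).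
pose eps : R := if 0 <= v then 1 else -1.
exists (fun z => vec2 (c * (z 0 0 - x 0 0) + s * (z 0 1 - x 0 1))
                  (eps * (c * (z 0 1 - x 0 1) - s * (z 0 0 - x 0 0)))).
  by apply: rigid_motion => //; rewrite /eps; case: ifP => _; ring.
split.
- by rewrite !subrr !mulr0 addr0 subr0 mulr0.
- rewrite ec es; congr vec2; last by ring.
  transitivity ((c ^+ 2 + s ^+ 2) * d); first by ring.
  by rewrite cs mul1r.
- by rewrite vec2E -/v /eps; case: ifP => [|/negbT]; rewrite -?ltNge; lra.
Qed.

End Plane.

(** * Mixed sides *)

Section Mixed.
Context {R : realType}.
Implicit Types (x y z w : 'rV[R]_2) (t e p q h k : R).

Lemma axis_lerp e s : 0 <= s <= e ->
  exists2 t, 0 <= t <= 1 & lerp t (vec2 0 0) (vec2 e 0) = vec2 s 0.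
Proof.
move=> /andP[s0 se]; have [e0|e0] := eqVneq e 0.
  exists 0; first by lra.
  by rewrite lerp0; congr vec2; lra.
have e1 : 0 < e by lra.
exists (s / e).
  by rewrite divr_ge0 ?ler_pdivrMr ?mul1r //; lra.
by rewrite lerp_vec2; congr vec2; field.
Qed.

Lemma covers_axis e p h q k :
  covers (vec2 0 0) (vec2 e 0) (vec2 p h) (vec2 q k) ->
  forall s, 0 <= s <= e -> 1 <= (s - p) ^+ 2 + h ^+ 2 \/ 1 <= (s - q) ^+ 2 + k ^+ 2.
Proof.
move=> cov s /axis_lerp[t t01 E]; move: (cov t t01).
by rewrite E !dist_ge1 !dist_vec2 !sub0r !sqrrN.
Qed.

Lemma not_away_axis e p h : 0 <= e -> ~ away (vec2 0 0) (vec2 e 0) (vec2 p h) ->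
  exists2 s, 0 <= s <= e & (s - p) ^+ 2 + h ^+ 2 < 1.
Proof.
move=> e0 /not_awayP[t /andP[t0 t1]].
rewrite ltNge dist_ge1 -ltNge lerp_vec2 dist_vec2 => d1.
exists (t * e); first by rewrite mulr_ge0 //= ler_piMl.
by move: d1; rewrite !mulr0 add0r addr0 sub0r sqrrN.
Qed.

(* The witness is the point of the side equidistant from the two vertices. *)
Lemma mixed_axis e p h q k : 0 <= e ->
  covers (vec2 0 0) (vec2 e 0) (vec2 p h) (vec2 q k) ->
  ~ away (vec2 0 0) (vec2 e 0) (vec2 p h) ->
  ~ away (vec2 0 0) (vec2 e 0) (vec2 q k) ->
  exists2 s, 0 <= s <= e &
    [/\ 1 <= (s - p) ^+ 2 + h ^+ 2, 1 <= (s - q) ^+ 2 + k ^+ 2,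
        (p - s) * (q - s) <= 0, h ^+ 2 < 1 & k ^+ 2 < 1].
Proof.
move=> e0 /covers_axis cov /not_away_axis-/(_ e0)[u u01 du] /not_away_axis-/(_ e0)[v v01 dv].
have h1 : h ^+ 2 < 1 by have := sqr_ge0 (u - p); lra.
have k1 : k ^+ 2 < 1 by have := sqr_ge0 (v - q); lra.
have du' : 1 <= (u - q) ^+ 2 + k ^+ 2 by case: (cov u u01) => //; lra.
have dv' : 1 <= (v - p) ^+ 2 + h ^+ 2 by case: (cov v v01) => //; lra.
have gu : (u - p) ^+ 2 + h ^+ 2 < (u - q) ^+ 2 + k ^+ 2 by lra.
have gv : (v - q) ^+ 2 + k ^+ 2 < (v - p) ^+ 2 + h ^+ 2 by lra.
have pq : p - q != 0.
  apply/eqP => pq; move: gu gv; have -> : p = q by lra.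
  lra.
pose s := (p ^+ 2 + h ^+ 2 - q ^+ 2 - k ^+ 2) / (2 * (p - q)).
have gs : (s - p) ^+ 2 + h ^+ 2 = (s - q) ^+ 2 + k ^+ 2 by rewrite /s; field.
(* The difference of the two squared distances is affine along the side and has opposite signs at
   [u] and [v], so its root [s] lies between them. *)
have [lu lv] : (0 < (p - q) * (u - s)) /\ (0 < (p - q) * (s - v)) by split; nra.
have s01 : 0 <= s <= e /\ (u < s < v \/ v < s < u).
  case: (ltrP 0 (p - q)) => pq'.
    have us : s < u by nra.
    have vs : v < s by nra.
    by split; [lra | right; lra].
  have us : u < s by nra.
  have vs : s < v by nra.
  by split; [lra | left; lra].
have {}cov : 1 <= (s - p) ^+ 2 + h ^+ 2 by case: (cov s s01.1); lra.
exists s; [exact: s01.1 | split => //; [lra|]].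
have Eu : (u - p) ^+ 2 < (s - p) ^+ 2 by lra.
have Ev : (v - q) ^+ 2 < (s - q) ^+ 2 by lra.
case: s01.2 => /andP[us sv].
  have ps : p < s by nra.
  have qs : s < q by nra.
  by nra.
have ps : s < p by nra.
have qs : q < s by nra.
by nra.
Qed.

Lemma perimeter_via x y z w v : dist y v + dist v z = dist y z ->
  dist x v + dist v w + dist w x <= quad_perimeter x y z w.
Proof.
move=> E; rewrite /quad_perimeter -E.
have := dist_triangle y x v; have := dist_triangle z v w; lra.
Qed.

Lemma dist_axis (a b : R) : dist (vec2 a 0) (vec2 b 0) = `|b - a|.
Proof. by rewrite distE !vec2E subrr expr0n /= addr0 sqrtr_sqr distrC. Qed.

Lemma axis_cat e s : 0 <= s <= e ->
  dist (vec2 0 0) (vec2 s 0) + dist (vec2 s 0) (vec2 e 0) = dist (vec2 0 0) (vec2 e 0).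
Proof. by move=> /andP[s0 se]; rewrite !dist_axis !ger0_norm; lra. Qed.

Lemma mixed_dichotomy e p h q k : 0 <= e -> 0 <= h ->
  covers (vec2 0 0) (vec2 e 0) (vec2 p h) (vec2 q k) ->
  ~ away (vec2 0 0) (vec2 e 0) (vec2 p h) ->
  ~ away (vec2 0 0) (vec2 e 0) (vec2 q k) ->
  339 / 100 <= quad_perimeter (vec2 p h) (vec2 0 0) (vec2 e 0) (vec2 q k) \/
  [/\ 0 < h <= 1, 0 < k <= 1,
      4 <= dist (vec2 p h) (vec2 q k) ^+ 2 + 2 * (h * k) + 2 * Num.max h k ^+ 2,
      2 + dist (vec2 p h) (vec2 q k) <=
        quad_perimeter (vec2 p h) (vec2 0 0) (vec2 e 0) (vec2 q k) &
      0 <= p \/ 0 <= q].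
Proof.
move=> e0 h0 cov nA nD.
have [s s01 [sA sD feet h1 k1]] := mixed_axis _ _ _ _ _ e0 cov nA nD.
have {cov nA nD} L := perimeter_via (vec2 p h) _ _ (vec2 q k) _ (axis_cat _ _ s01).
have dA : 1 <= dist (vec2 p h) (vec2 s 0).
  by rewrite dist_ge1 dist_vec2 subr0; nra.
have dD : 1 <= dist (vec2 s 0) (vec2 q k).
  by rewrite dist_ge1 dist_vec2 sub0r; nra.
rewrite (distC (vec2 q k)) in L.
have := dist_ge0 (vec2 p h) (vec2 q k); have := dist_vec2 p h q k.
move: (dist (vec2 p h) (vec2 q k)) L => d L Ed d0.
(* If the angle at (s, 0) between A and D is not acute, then AD^2 >= 2, and the triangle with these
   three vertices already has perimeter at least 2 + 139/100. *)
have [obt|hk] := lerP (h * k) (- ((p - s) * (q - s))).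
  left; apply: le_trans L; suff : 139 / 100 <= d by lra.
  rewrite -(ler_pXn2r (n := 2)) ?nnegrE //; nra.
right; have k0 : 0 < k by nra.
have h0' : 0 < h by nra.
have h1' : h <= 1 by nra.
have k1' : k <= 1 by nra.
split; rewrite ?h0' ?k0 //; [|lra|nra].
rewrite Ed; set M := Num.max h k.
have M0 : 0 <= M by rewrite /M le_max h0.
have M1 : M <= 1 by rewrite /M ge_max h1' k1'.
have hM : h ^+ 2 <= M ^+ 2 by rewrite ler_pXn2r ?nnegrE // /M le_max lexx.
have kM : k ^+ 2 <= M ^+ 2 by rewrite ler_pXn2r ?nnegrE ?(ltW k0) // /M le_max lexx orbT.
(* Both |p - s| and |q - s| are at least sqrt (1 - M^2); their product is the cross term in the
   expansion of AD^2. *)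
suff key : 1 - M ^+ 2 <= - ((p - s) * (q - s)) by nra.
have MM : 0 <= 1 - M ^+ 2 by nra.
have PQ : 0 <= - ((p - s) * (q - s)) by nra.
have P2 : 1 - M ^+ 2 <= (p - s) ^+ 2 by nra.
have Q2 : 1 - M ^+ 2 <= (q - s) ^+ 2 by nra.
rewrite -(ler_pXn2r (n := 2)) ?nnegrE //.
by rewrite sqrrN exprMn [leLHS]expr2; exact: ler_pM.
Qed.

End Mixed.

(** * Patterns around a mixed side of length at least 1 *)

Section Trapezoid.
Context {R : realType}.
Implicit Types (A B C D : 'rV[R]_2) (t e p q h k d : R).

Lemma rigid_perimeter g A B C D : rigid g ->
  quad_perimeter (g A) (g B) (g C) (g D) = quad_perimeter A B C D.
Proof. by case=> dg _ _; rewrite /quad_perimeter !dg. Qed.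

Lemma perimeter_rot A B C D : quad_perimeter A B C D = quad_perimeter B C D A.
Proof. by rewrite /quad_perimeter; ring. Qed.

Lemma perimeter_rev A B C D : quad_perimeter A B C D = quad_perimeter C B A D.
Proof.
by rewrite /quad_perimeter (distC C B) (distC B A) (distC A D) (distC D C); ring.
Qed.

Lemma mixed_frame A B C D : covers B C A D -> ~ away B C A -> ~ away B C D ->
  339 / 100 <= quad_perimeter A B C D \/
  exists2 g, rigid g & exists p h q k,
  [/\ g A = vec2 p h, g B = vec2 0 0, g C = vec2 (dist B C) 0, g D = vec2 q k &
   [/\ 0 < h <= 1, 0 < k <= 1,
      4 <= dist A D ^+ 2 + 2 * (h * k) + 2 * Num.max h k ^+ 2,
      2 + dist A D <= quad_perimeter A B C D &
      0 <= p \/ 0 <= q]].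
Proof.
move=> cov nA nD.
have [g ig [gB gC gA]] := frame_axis B C A.
have {}cov := (rigid_covers g B C A D ig).2 cov.
have {}nA : ~ away (g B) (g C) (g A) by move=> aw; apply: nA; exact: (rigid_away g B C A ig).1.
have {}nD : ~ away (g B) (g C) (g D) by move=> aw; apply: nD; exact: (rigid_away g B C D ig).1.
move: cov nA nD; rewrite -(rigid_perimeter g A B C D ig) gB gC.
rewrite (vec2_eta (g A)) (vec2_eta (g D)) => cov nA nD.
case: (mixed_dichotomy _ _ _ _ _ (dist_ge0 B C) gA cov nA nD) => [|P]; [by left|right].
exists g => //; exists (g A 0 0), (g A 0 1), (g D 0 0), (g D 0 1).
by split; rewrite -?vec2_eta //; move: P; rewrite -!vec2_eta; case: ig => ->.
Qed.

Lemma mixed_heights A B C D : covers B C A D -> ~ away B C A -> ~ away B C D ->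
  339 / 100 <= quad_perimeter A B C D \/ exists h k,
  [/\ [/\ 0 < h <= 1, 0 < k <= 1, h <= dist A B & k <= dist C D],
      4 <= dist A D ^+ 2 + 2 * (h * k) + 2 * Num.max h k ^+ 2 &
      2 + dist A D <= quad_perimeter A B C D].
Proof.
move=> cov nA nD; case: (mixed_frame _ _ _ _ cov nA nD) => [|H]; [by left|right].
case: H => g [dg _ _] [p [h [q [k [gA gB gC gD [h01 k01 H1 H2 _]]]]]].
exists h, k; split=> //; split=> //.
  by rewrite -dg gA gB; apply: le_dist; rewrite dist_vec2 !subr0 lerDr sqr_ge0.
by rewrite -dg gC gD; apply: le_dist; rewrite dist_vec2 sub0r sqrrN lerDr sqr_ge0.
Qed.

(** Because h k + max^2 = max (h + k), and the maximum is at most 1. *)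
Lemma mixed_sum h k d : 0 <= h <= 1 -> 0 <= k <= 1 ->
  4 <= d ^+ 2 + 2 * (h * k) + 2 * Num.max h k ^+ 2 -> 4 <= d ^+ 2 + 2 * (h + k).
Proof. by case: (leP h k) => hk h01 k01 H; nra. Qed.

(** AB and CD are at least the heights h and k, so with d = AD the perimeter is at least 1 + d + (4
    - d^2) / 2, enough for d up to 139/100; beyond that, 2 + d is enough. *)
Lemma mixed_split A B C D : covers B C A D -> ~ away B C A -> ~ away B C D ->
  1 <= dist B C -> 1 <= dist A D -> 339 / 100 <= quad_perimeter A B C D.
Proof.
move=> cov nA nD e1 d1.
case: (mixed_heights _ _ _ _ cov nA nD) => // -[h [k [[h01 k01 hA kD] H L]]].
have S : 4 <= dist A D ^+ 2 + 2 * (h + k) by apply: mixed_sum H; lra.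
case: (lerP (139/100) (dist A D)) => d2; first by lra.
have : 0 <= (dist A D - 1) * (139 / 100 - dist A D) by apply: mulr_ge0; lra.
by rewrite /quad_perimeter (distC D A); lra.
Qed.

(** If the foot of the perpendicular from C = (e, 0) lies on the side, it is at distance at least 1
    and h <= 1 converts this into the bound; otherwise AC >= 1 gives it. *)
Lemma away_foot e p h : 0 <= h <= 1 -> 0 <= e ->
  away (vec2 p h) (vec2 0 0) (vec2 e 0) -> 0 <= p -> 1 + p ^+ 2 <= e ^+ 2.
Proof.
move=> h01 e0 aw p0; have := away_r _ _ _ aw; have := away_l _ _ _ aw.
rewrite !dist_ge1 !dist_vec2 => dA dB.
case: (lerP (e * p) (p ^+ 2 + h ^+ 2)) => ep; last by nra.
have [n0|n0] := eqVneq (p ^+ 2 + h ^+ 2) 0; first by nra.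
have n1 : 0 < p ^+ 2 + h ^+ 2 by rewrite lt_neqAle eq_sym n0; nra.
pose t := e * p / (p ^+ 2 + h ^+ 2).
have t01 : 0 <= t <= 1.
  by rewrite /t divr_ge0 ?mulr_ge0 ?(ltW n1) //= ler_pdivrMr // mul1r.
have := aw (1 - t); rewrite lerp_vec2 dist_ge1 dist_vec2.
have -> : ((1 - (1 - t)) * p + (1 - t) * 0 - e) ^+ 2 +
  ((1 - (1 - t)) * h + (1 - t) * 0 - 0) ^+ 2 = e ^+ 2 * h ^+ 2 / (p ^+ 2 + h ^+ 2).
  by rewrite /t; field.
have -> : 0 <= 1 - t <= 1 by lra.
rewrite ler_pdivlMr // => /(_ isT) H.
have : 0 <= (e ^+ 2 - 1) * (1 - h ^+ 2) by apply: mulr_ge0; nra.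
by lra.
Qed.

(** Mirror CD in the first axis and translate it so that it continues AB at B; this is then the
    triangle inequality. *)
Lemma slanted_sides e p h q k : h + k >= 0 ->
  (p + e - q) ^+ 2 + (h + k) ^+ 2 <=
  (dist (vec2 p h) (vec2 0 0) + dist (vec2 e 0) (vec2 q k)) ^+ 2.
Proof.
move=> hk0; have -> : dist (vec2 e 0) (vec2 q k) = dist (vec2 0 0) (vec2 (q - e) (- k)).
  by apply/eqP; rewrite -(@eqrXn2 _ 2) ?dist_ge0 // !dist_vec2; apply/eqP; ring.
have -> : (p + e - q) ^+ 2 + (h + k) ^+ 2 = dist (vec2 p h) (vec2 (q - e) (- k)) ^+ 2.
  by rewrite dist_vec2; ring.
by apply: sqr_le; [exact: dist_ge0 | exact: dist_triangle].
Qed.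

(** Common reduction for the patterns with BC mixed: what remains is to establish one of the three
    alternatives of [trapezoid_final], in a frame where BC lies on the first axis. *)
Lemma mixed_trapezoid A B C D (e := dist B C) (d := dist A D) :
  covers B C A D -> ~ away B C A -> ~ away B C D -> 1 <= e ->
  339 / 100 <= quad_perimeter A B C D \/
  exists2 g, rigid g & exists p h q k,
  [/\ g A = vec2 p h, g B = vec2 0 0, g C = vec2 e 0, g D = vec2 q k &
   [/\ 0 < h <= 1, 0 < k <= 1, 0 <= p \/ 0 <= q, d ^+ 2 = (p - q) ^+ 2 + (h - k) ^+ 2 &
     d < 1 /\ (1 + (e - d) ^+ 2 / 4 <= e ^+ 2 \/
       d <= 1 / 2 /\ 1 + (1 - 2 * d) ^+ 2 <= e ^+ 2 \/ 1 / 2 <= d ->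
     339 / 100 <= quad_perimeter A B C D)]].
Proof.
rewrite {}/e {}/d => cov nA nD e1.
case: (lerP 1 (dist A D)) => d1; first by left; exact: mixed_split.
case: (mixed_frame _ _ _ _ cov nA nD) => [|H]; [by left|right].
case: H => g ig [p [h [q [k [gA gB gC gD [h01 k01 H _ pq]]]]]].
have [dg _ _] := ig.
exists g => //; exists p, h, q, k; split=> //.
have dE : dist A D ^+ 2 = (p - q) ^+ 2 + (h - k) ^+ 2 by rewrite -dg gA gD dist_vec2.
split=> //; split=> // cases.
have h0 : 0 <= h <= 1 by lra.
have k0 : 0 <= k <= 1 by lra.
have S := mixed_sum _ _ _ h0 k0 H.
have pq' : q - p <= dist A D.
  by apply: sqr_le_cancel; rewrite ?dist_ge0 // dE; have := sqr_ge0 (h - k); lra.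
have d0 : 0 <= dist A D < 1 by rewrite dist_ge0.
have hk0 : 0 <= h + k by lra.
have Y := slanted_sides (dist B C) p h q k hk0.
rewrite -gA -gB -gC -gD !dg in Y.
have y0 : 0 <= dist A B + dist C D by rewrite addr_ge0 ?dist_ge0.
have em : dist B C - dist A D <= p + dist B C - q by lra.
have := trapezoid_scalar _ _ _ _ _ d0 e1 S em y0 Y cases.
by rewrite /quad_perimeter (distC D A); lra.
Qed.

Lemma away_foot_mirror e q k : 0 <= k <= 1 -> 0 <= e ->
  away (vec2 e 0) (vec2 q k) (vec2 0 0) -> 0 <= e - q -> 1 + (e - q) ^+ 2 <= e ^+ 2.
Proof.
move=> k01 e0 aw.
have rg : rigid (fun z => vec2 (e - z 0 0) (z 0 1)).
  have [c s] : (-1) ^+ 2 + 0 ^+ 2 = 1 :> R /\ (-1) ^+ 2 = 1 :> R by split; ring.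
  have := rigid_motion (-1) 0 (-1) (vec2 e 0) c s.
  by congr rigid; apply/funext => z; rewrite !vec2E; congr vec2; ring.
have {rg} := (rigid_away _ (vec2 e 0) (vec2 q k) (vec2 0 0) rg).2 aw.
rewrite !vec2E subrr subr0 => /awayC {}aw.
exact: (away_foot e _ k).
Qed.

(* In the names below, a digit or letter stands for each of the consecutive sides AB, BC, CD, DA:
   0 when it is away from the next vertex (C for AB), 1 when it is away from the previous one
   (D for AB), M when it is mixed. *)
Lemma mixed_0M1 A B C D : covers B C A D -> ~ away B C A -> ~ away B C D ->
  away A B C -> away C D B -> 339 / 100 <= quad_perimeter A B C D.
Proof.
move=> cov nA nD aC aB; have e1 := away_r _ _ _ aC.
case: (mixed_trapezoid _ _ _ _ cov nA nD e1) => // -[g ig].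
case=> p [h [q [k [gA gB gC gD [h01 k01 _ dE [d1]]]]]]; apply; left.
have := (rigid_away g A B C ig).2 aC; have {aC aB} := (rigid_away g C D B ig).2 aB.
rewrite gA gB gC gD; move: (dist B C) (dist A D) (dist_ge0 A D) e1 dE d1 => e d d0 e1 dE d1.
move=> aB aC; have e0 : 0 <= e by lra.
have h0 : 0 <= h <= 1 by lra.
have k0 : 0 <= k <= 1 by lra.
have pq : q - p <= d by apply: sqr_le_cancel => //; rewrite dE; have := sqr_ge0 (h - k); lra.
(* Since p + (e - q) >= e - d, the projection of A or of D on BC is at least (e - d) / 2 away from B
   or C respectively, and [away_foot] applies there. *)
have half u : (e - d) / 2 <= u -> 1 + u ^+ 2 <= e ^+ 2 -> 1 + (e - d) ^+ 2 / 4 <= e ^+ 2.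
  move=> hu; have : ((e - d) / 2) ^+ 2 <= u ^+ 2 by apply: sqr_le; lra.
  by rewrite expr_div_n; lra.
case: (lerP ((e - d) / 2) p) => hp.
  by apply: (half p) => //; apply: away_foot aC _ => //; lra.
apply: (half (e - q)); first by lra.
by apply: away_foot_mirror aB _ => //; lra.
Qed.

(** The witness of [mixed_axis] is at distance at least 1 from D, hence at least 1 - CD from C. D
    projects on the same side of it as C, so A projects on the other one, and the angle there
    between A and C is not acute. *)
Lemma mixed_diagonal A B C D : covers B C A D -> ~ away B C A -> ~ away B C D ->
  dist C D <= 1 / 2 -> 1 + (1 - dist C D) ^+ 2 <= dist A C ^+ 2.
Proof.
move=> cov nA nD d1.
have [g ig [gB gC gA]] := frame_axis B C A.
have {}cov := (rigid_covers g B C A D ig).2 cov.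
have {}nA : ~ away (g B) (g C) (g A) by move=> aw; apply: nA; exact: (rigid_away g B C A ig).1.
have {}nD : ~ away (g B) (g C) (g D) by move=> aw; apply: nD; exact: (rigid_away g B C D ig).1.
have [dg _ _] := ig; rewrite -!(dg C) -(dg A).
move: cov nA nD d1; rewrite -!(dg C) gB gC.
move: (dist B C) (dist_ge0 B C) => e e0.
rewrite (vec2_eta (g A)) (vec2_eta (g D)).
move: (g A 0 0) (g A 0 1) (g D 0 0) (g D 0 1) => p h q k cov nA nD d1.
have [s s01 [sA sD feet _ _]] := mixed_axis _ _ _ _ _ e0 cov nA nD.
have d0 := dist_ge0 (vec2 e 0) (vec2 q k); have dE := dist_vec2 e 0 q k.
rewrite dist_vec2 subr0; move: (dist _ _) d1 d0 dE => d d1 d0 dE.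
have es : 1 - d <= e - s.
  have sD' : 1 <= dist (vec2 s 0) (vec2 q k).
    by rewrite dist_ge1 dist_vec2 sub0r sqrrN.
  have := dist_triangle (vec2 e 0) (vec2 s 0) (vec2 q k).
  have -> : dist (vec2 s 0) (vec2 e 0) = e - s by rewrite dist_axis ger0_norm; lra.
  have -> : dist (vec2 e 0) (vec2 q k) = d.
    by apply/eqP; rewrite -(@eqrXn2 _ 2) ?dist_ge0 // dist_vec2 dE.
  by lra.
have E2 : (1 - d) ^+ 2 <= (e - s) ^+ 2 by apply: sqr_le; lra.
have qs : 0 < (q - s) * (e - s).
  have : 0 < 1 + (1 - d) ^+ 2 - d ^+ 2 by lra.
  by move: dE; lra.
have {}qs : s < q by move: qs; rewrite pmulr_lgt0; lra.
have ps : p <= s by move: feet; rewrite pmulr_lle0; lra.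
have : 0 <= (s - p) * (e - s) by apply: mulr_ge0; lra.
by lra.
Qed.

(** When AD is short, [mixed_diagonal] for the side CD makes BD long. This moves D, and A with it,
    to the right of B, and [away_foot] then makes BC long. *)
Lemma mixed_0MM A B C D : covers B C A D -> ~ away B C A -> ~ away B C D ->
  covers C D B A -> ~ away C D B -> ~ away C D A ->
  away A B C -> 339 / 100 <= quad_perimeter A B C D.
Proof.
move=> cov nA nD cov' nB' nA' aC; have e1 := away_r _ _ _ aC.
case: (mixed_trapezoid _ _ _ _ cov nA nD e1) => // -[g ig].
case=> p [h [q [k [gA gB gC gD [h01 k01 pq dE [d1]]]]]]; apply; right.
case: (lerP (dist A D) (1 / 2)) => d2; [left|by right; lra].
split=> //; have := (mixed_diagonal _ _ _ _ cov' nB' nA').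
rewrite (distC D A) => /(_ d2); have [dg _ _] := ig; rewrite -(dg B) gB gD.
have := (rigid_away g A B C ig).2 aC; rewrite gA gB gC.
rewrite dist_vec2 !sub0r !sqrrN.
move: (dist B C) (dist A D) (dist_ge0 A D) e1 dE d1 d2 => e d d0 e1 dE _ d2 {}aC Q.
have e0 : 0 <= e by lra.
have h0 : 0 <= h <= 1 by lra.
have hk := sqr_ge0 (h - k).
have qp : q - p <= d by apply: sqr_le_cancel => //; rewrite dE; lra.
have pq' : p - q <= d by apply: sqr_le_cancel => //; rewrite dE; lra.
have k1 : k ^+ 2 <= 1 by rewrite -(expr1n _ 2); apply: sqr_le; lra.
have Q1 : (1 - d) ^+ 2 <= q ^+ 2 by lra.
have q0 : 1 - d <= q \/ q <= - (1 - d).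
  case: (lerP 0 q) => q0; [left|right]; first by apply: sqr_le_cancel.
  suff : 1 - d <= - q by lra.
  by apply: sqr_le_cancel; [lra | rewrite sqrrN].
have p0 : 1 - 2 * d <= p by case: q0; case: pq; lra.
have pp : 0 <= p by lra.
have := away_foot _ _ _ h0 e0 aC pp.
have : (1 - 2 * d) ^+ 2 <= p ^+ 2 by apply: sqr_le; lra.
by lra.
Qed.

End Trapezoid.

(** * Excluded cyclic patterns of side types *)

Section SideTypes.
Context {R : realType}.
Implicit Types (A B C D : 'rV[R]_2) (a c h k d : R).

(** With P = X + x and Q = Y + y, the hypotheses add up to P^2 + Q^2 >= 6 where P, Q <= 2; hence P +
    Q >= 2 + sqrt 2, as for P = 2 and Q = sqrt 2. *)
Lemma mixed_sum_bound (X x Y y : R) : 0 <= x <= X -> X <= 1 -> 0 <= y <= Y -> Y <= 1 ->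
  4 <= y ^+ 2 + 2 * (X * (X + x)) -> 4 <= x ^+ 2 + 2 * (Y * (Y + y)) ->
  339 / 100 <= X + x + Y + y.
Proof.
move=> x01 X1 y01 Y1 H1 H2.
have PQ : 6 <= (X + x) ^+ 2 + (Y + y) ^+ 2.
  have X2 : X ^+ 2 <= 1 by rewrite -(expr1n _ 2); apply: sqr_le; lra.
  have Y2 : Y ^+ 2 <= 1 by rewrite -(expr1n _ 2); apply: sqr_le; lra.
  by lra.
have : 0 <= (2 - (X + x)) * (2 - (Y + y)) by apply: mulr_ge0; lra.
have : 0 <= (X + x) * (Y + y) by apply: mulr_ge0; lra.
have : 0 <= X + x + (Y + y) by lra.
rewrite -!addrA (addrA X x); move: (X + x) (Y + y) PQ => P Q PQ s0 m0 m2.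
by nra.
Qed.

(** Passes from heights to side lengths: both heights are at most min (a, 1), and k is at most c as
    well. *)
Lemma mixed_truncate h k a c d : 0 < h <= 1 -> 0 < k <= 1 -> h <= a -> k <= c -> c <= a ->
  4 <= d ^+ 2 + 2 * (h * k) + 2 * Num.max h k ^+ 2 ->
  4 <= d ^+ 2 + 2 * (Num.min a 1 * (Num.min a 1 + c)).
Proof.
move=> h01 k01 ha kc ca H; apply: le_trans H _.
rewrite -addrA lerD2l -mulrDr ler_pM2l // mulrDr addrC.
have hX : h <= Num.min a 1 by rewrite le_min ha; lra.
have kX : k <= Num.min a 1 by rewrite le_min; lra.
apply: lerD.
  by rewrite -expr2; apply: sqr_le; rewrite ?le_max ?ge_max ?hX ?kX //; lra.
by apply: ler_pM => //; lra.
Qed.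

Lemma mixed_adjacent A B C D :
  covers A B D C -> ~ away A B D -> ~ away A B C ->
  covers B C A D -> ~ away B C A -> ~ away B C D ->
  dist C D <= dist A B -> dist D A <= dist B C -> dist C D < 1 -> dist D A < 1 ->
  339 / 100 <= quad_perimeter A B C D.
Proof.
move=> covA nD nC covB nA nD' ca db c1 d1.
case: (mixed_heights _ _ _ _ covB nA nD') => // -[h [k [[h01 k01 hA kD] H _]]].
case: (mixed_heights _ _ _ _ covA nD nC); first by move=> L; rewrite -perimeter_rot.
case=> h' [k' [[h01' k01' hA' kD'] H' _]].
rewrite (distC A D) in H; rewrite (distC D C) in H'.
have {}H := mixed_truncate _ _ _ _ _ h01 k01 hA kD ca H.
rewrite maxC (mulrC h') in H'.
have {}H' := mixed_truncate _ _ _ _ _ k01' h01' kD' hA' db H'.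
have ma : dist C D <= Num.min (dist A B) 1 by rewrite le_min ca ltW.
have mb : dist D A <= Num.min (dist B C) 1 by rewrite le_min db ltW.
have := mixed_sum_bound _ _ _ _ _ _ _ _ H H'.
rewrite !dist_ge0 ma mb !ge_min !lexx !orbT => /(_ isT isT isT isT) L.
apply: le_trans L _; rewrite /quad_perimeter.
have := ge_min (dist A B) (dist A B) 1; have := ge_min (dist B C) (dist B C) 1.
by rewrite !lexx /=; lra.
Qed.

Definition covered A B C D : Prop :=
  [/\ covers A B C D, covers B C D A, covers C D A B & covers D A B C].

Lemma covered_rot A B C D : covered A B C D -> covered B C D A.
Proof. by case. Qed.

Lemma covered_rev A B C D : covered A B C D -> covered C B A D.
Proof. by case=> h1 h2 h3 h4; split; apply: coversC. Qed.

Definition mixed A B C D : Prop := ~ away A B C /\ ~ away A B D.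

(** A rotation makes AB and BC the longer sides of the two opposite pairs. If CD or DA reaches 1, so
    does its opposite side and [mixed_split] applies; otherwise [mixed_adjacent] does. *)
Lemma all_mixed A B C D : covered A B C D -> mixed A B C D -> mixed B C D A ->
  mixed C D A B -> mixed D A B C -> 339 / 100 <= quad_perimeter A B C D.
Proof.
wlog [ca db] : A B C D / dist C D <= dist A B /\ dist D A <= dist B C.
  move=> W cov m1 m2 m3 m4.
  case: (lerP (dist C D) (dist A B)) => ca; case: (lerP (dist D A) (dist B C)) => db.
  - exact: W.
  - rewrite 3!perimeter_rot; apply: W => //; last by do 3!apply: covered_rot.
    by split=> //; apply: ltW.
  - rewrite perimeter_rot; apply: W => //; last by apply: covered_rot.
    by split=> //; apply: ltW.
  - rewrite 2!perimeter_rot; apply: W => //; last by do 2!apply: covered_rot.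
    by split; apply: ltW.
case=> c1 c2 c3 c4 [m1 m1'] [m2 m2'] [m3 m3'] [m4 m4'].
case: (lerP 1 (dist C D)) => hc.
  rewrite perimeter_rot perimeter_rot perimeter_rot.
  by apply: mixed_split => //; [exact: covers_swap | lra | rewrite distC].
case: (lerP 1 (dist D A)) => hd.
  by apply: mixed_split => //; [exact: covers_swap | lra | rewrite distC].
by apply: mixed_adjacent => //; exact: covers_swap.
Qed.

(** A side of type 0 makes the following side at least 1, here BC and DA, which are opposite. *)
Lemma no_0M0 A B C D : covered A B C D -> away A B C -> mixed B C D A -> away C D A ->
  339 / 100 <= quad_perimeter A B C D.
Proof.
case=> _ cov _ _ h0 [nD nA] h1.
by apply: mixed_split => //; [exact: covers_swap | exact: away_r h0 |
  rewrite distC; exact: away_r h1].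
Qed.

Lemma no_0M1 A B C D : covered A B C D -> away A B C -> mixed B C D A -> away C D B ->
  339 / 100 <= quad_perimeter A B C D.
Proof.
case=> _ cov _ _ h0 [nD nA] h1.
by apply: mixed_0M1 => //; exact: covers_swap.
Qed.

Lemma no_0MM A B C D : covered A B C D -> away A B C -> mixed B C D A -> mixed C D A B ->
  339 / 100 <= quad_perimeter A B C D.
Proof.
case=> _ cov cov' _ h0 [nD nA] [nA' nB].
by apply: mixed_0MM => //; exact: covers_swap.
Qed.

Lemma no_0000 A B C D : away A B C -> away B C D -> away C D A -> away D A B ->
  339 / 100 <= quad_perimeter A B C D.
Proof.
move=> /away_r h1 /away_r h2 /away_r h3 /away_r h4.
by rewrite /quad_perimeter; lra.
Qed.

Lemma mixed_rev A B C D : mixed A B C D -> mixed B A D C.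
Proof. by case=> h1 h2; split=> /awayC. Qed.

Lemma perimeter_mirror A B C D : quad_perimeter A B C D = quad_perimeter D C B A.
Proof. by rewrite perimeter_rev -perimeter_rot. Qed.

Lemma covered_mirror A B C D : covered A B C D -> covered D C B A.
Proof. by move=> /covered_rev; do 3!move=> /covered_rot. Qed.

(** Reversing the cyclic order exchanges the types 0 and 1; [no_MM1] and [no_1111] follow in the
    same way. *)
Lemma no_1M1 A B C D : covered A B C D -> away A B D -> mixed B C D A -> away C D B ->
  339 / 100 <= quad_perimeter A B C D.
Proof.
move=> /covered_mirror cov /awayC h /mixed_rev m /awayC h'.
by rewrite perimeter_mirror; apply: no_0M0.
Qed.

Lemma no_MM1 A B C D : covered A B C D -> mixed A B C D -> mixed B C D A -> away C D B ->
  339 / 100 <= quad_perimeter A B C D.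
Proof.
move=> /covered_mirror cov /mixed_rev m /mixed_rev m' /awayC h.
by rewrite perimeter_mirror; apply: no_0MM.
Qed.

Lemma no_1111 A B C D : away A B D -> away B C A -> away C D B -> away D A C ->
  339 / 100 <= quad_perimeter A B C D.
Proof.
move=> /awayC h1 /awayC h2 /awayC h3 /awayC h4.
by rewrite perimeter_mirror; apply: no_0000.
Qed.

Lemma side_type A B C D : away A B C \/ away A B D \/ mixed A B C D.
Proof.
have [|] := pselect (away A B C); first by left.
by have [|] := pselect (away A B D); [right; left | right; right].
Qed.

(** The vertex sought is a factor 01 of the cyclic word of side types. A block of M can neither
    follow 0 nor precede 1, so a stretch without M between blocks begins with 0, ends with 1 and
    contains 01. A word without M is constant or contains 01. *)
Lemma mutual_vertex A B C D : covered A B C D ->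
  339 / 100 <= quad_perimeter A B C D \/
  ((away A B C /\ away B C A) \/ (away B C D /\ away C D B)) \/
  ((away C D A /\ away D A C) \/ (away D A B /\ away A B D)).
Proof.
move=> cov; have covB := covered_rot _ _ _ _ cov; have covC := covered_rot _ _ _ _ covB.
have covD := covered_rot _ _ _ _ covC.
have E1 := perimeter_rot A B C D; have E2 := perimeter_rot B C D A.
have E3 := perimeter_rot C D A B.
have := no_0M0 _ _ _ _ cov; have := no_0M1 _ _ _ _ cov; have := no_0MM _ _ _ _ cov.
have := no_1M1 _ _ _ _ cov; have := no_MM1 _ _ _ _ cov.
have := all_mixed _ _ _ _ cov; have := no_1111 A B C D; have := no_0000 A B C D.
have := no_0M0 _ _ _ _ covB; have := no_0M1 _ _ _ _ covB; have := no_0MM _ _ _ _ covB.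
have := no_1M1 _ _ _ _ covB; have := no_MM1 _ _ _ _ covB.
have := no_0M0 _ _ _ _ covC; have := no_0M1 _ _ _ _ covC; have := no_0MM _ _ _ _ covC.
have := no_1M1 _ _ _ _ covC; have := no_MM1 _ _ _ _ covC.
have := no_0M0 _ _ _ _ covD; have := no_0M1 _ _ _ _ covD; have := no_0MM _ _ _ _ covD.
have := no_1M1 _ _ _ _ covD; have := no_MM1 _ _ _ _ covD.
rewrite -E3 -E2 -E1.
move: (side_type A B C D) (side_type B C D A) (side_type C D A B) (side_type D A B C).
move: (339 / 100 <= quad_perimeter A B C D) => G.
move: (away A B C) (away A B D) (mixed A B C D) => a0 a1 am.
move: (away B C D) (away B C A) (mixed B C D A) => b0 b1 bm.
move: (away C D A) (away C D B) (mixed C D A B) => c0 c1 cm.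
move: (away D A B) (away D A C) (mixed D A B C) => d0 d1 dm.
move=> {E1 E2 E3 cov covB covC covD} [ha|[ha|ha]] [hb|[hb|hb]] [hc|[hc|hc]] [hd|[hd|hd]];
  intros; first [by right; left; left | by right; left; right | by right; right; left
   | by right; right; right | by left; auto].
Qed.

End SideTypes.

(** * A vertex with mutually distant sides *)

Section BisectorFrame.
Context {R : realType}.
Implicit Types (A B C D : 'rV[R]_2) (a b c s x y p q : R).

(** The vector is the unit normal through the point of the segment nearest to the origin; that point
    is an end or the foot of the perpendicular. *)
Lemma separation (x0 x1 y0 y1 : R) : away (vec2 x0 x1) (vec2 y0 y1) (vec2 0 0) ->
  exists p q, [/\ p ^+ 2 + q ^+ 2 = 1, 1 <= p * x0 + q * x1 & 1 <= p * y0 + q * y1].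
Proof.
move=> aw.
suff [e0 [e1 [n1 hx hy]]] : exists e0 e1, [/\ 1 <= e0 ^+ 2 + e1 ^+ 2,
    e0 ^+ 2 + e1 ^+ 2 <= e0 * x0 + e1 * x1 & e0 ^+ 2 + e1 ^+ 2 <= e0 * y0 + e1 * y1].
  pose n := Num.sqrt (e0 ^+ 2 + e1 ^+ 2).
  have nn : n ^+ 2 = e0 ^+ 2 + e1 ^+ 2 by rewrite sqr_sqrtr //; exact: le_trans n1.
  have n1' : 1 <= n.
    by apply: sqr_le_cancel; rewrite ?sqrtr_ge0 // nn expr1n.
  have n0 : 0 < n := lt_le_trans ltr01 n1'.
  have one u v : n ^+ 2 <= e0 * u + e1 * v -> 1 <= e0 / n * u + e1 / n * v.
    move=> h; have -> : e0 / n * u + e1 / n * v = (e0 * u + e1 * v) / n.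
      by field; rewrite gt_eqF.
    rewrite ler_pdivlMr // mul1r; apply: le_trans h.
    by rewrite expr2 ler_peMl // ltW.
  exists (e0 / n), (e1 / n); split; [|by apply: one; rewrite nn..].
  by rewrite !expr_div_n -mulrDl -nn divff // sqrf_eq0 gt_eqF.
pose u0 := y0 - x0; pose u1 := y1 - x1.
have dX := away_l _ _ _ aw; have dY := away_r _ _ _ aw.
rewrite dist_ge1 dist_vec2 !subr0 in dX; rewrite dist_ge1 dist_vec2 !subr0 in dY.
case: (lerP 0 (x0 * u0 + x1 * u1)) => hX.
  by exists x0, x1; split=> //; move: hX; rewrite /u0 /u1; lra.
case: (lerP (y0 * u0 + y1 * u1) 0) => hY.
  by exists y0, y1; split=> //; move: hY; rewrite /u0 /u1; lra.
pose k := u0 ^+ 2 + u1 ^+ 2.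
have kE : (y0 * u0 + y1 * u1) - (x0 * u0 + x1 * u1) = k by rewrite /k /u0 /u1; ring.
have k0 : 0 < k by rewrite -kE; lra.
pose t := - (x0 * u0 + x1 * u1) / k.
have t01 : 0 <= t <= 1.
  by rewrite /t divr_ge0 ?(ltW k0) ?oppr_ge0 ?(ltW hX) //= ler_pdivrMr // mul1r -kE; lra.
have := aw t t01; rewrite lerp_vec2 dist_ge1 dist_vec2 !subr0.
set e0 := (1 - t) * x0 + t * y0; set e1 := (1 - t) * x1 + t * y1 => n1.
have perp : e0 * u0 + e1 * u1 = 0.
  have -> : e0 * u0 + e1 * u1 = x0 * u0 + x1 * u1 + t * k.
    by rewrite /e0 /e1 /k /u0 /u1; ring.
  by rewrite /t divfK ?gt_eqF // subrr.
exists e0, e1; split=> //.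
  have -> : e0 * x0 + e1 * x1 = e0 ^+ 2 + e1 ^+ 2 - t * (e0 * u0 + e1 * u1).
    by rewrite /e0 /e1 /u0 /u1; ring.
  by rewrite perp mulr0 subr0.
have -> : e0 * y0 + e1 * y1 = e0 ^+ 2 + e1 ^+ 2 + (1 - t) * (e0 * u0 + e1 * u1).
  by rewrite /e0 /e1 /u0 /u1; ring.
by rewrite perp mulr0 addr0.
Qed.

(* [AD + DC] is bounded below by projecting AD on [(k1, k2)] and CD on its mirror image. *)
Lemma perimeter_project s c a b x y k1 k2 : s ^+ 2 + c ^+ 2 = 1 -> 0 <= a -> 0 <= b ->
  k1 ^+ 2 + k2 ^+ 2 = 1 ->
  (a + b) * (1 + s * k1 - c * k2) + 2 * y * k2 <=
  quad_perimeter (vec2 (- (a * s)) (a * c)) (vec2 0 0) (vec2 (b * s) (b * c)) (vec2 x y).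
Proof.
move=> u a0 b0 k12; rewrite /quad_perimeter.
have -> : dist (vec2 (- (a * s)) (a * c)) (vec2 0 0) = a.
  apply/eqP; rewrite -(@eqrXn2 _ 2) ?dist_ge0 // dist_vec2; apply/eqP.
  by rewrite -[RHS]mulr1 -u; ring.
have -> : dist (vec2 0 0) (vec2 (b * s) (b * c)) = b.
  apply/eqP; rewrite -(@eqrXn2 _ 2) ?dist_ge0 // dist_vec2; apply/eqP.
  by rewrite -[RHS]mulr1 -u; ring.
have h1 := dist_linear k1 k2 (vec2 x y) (vec2 (- (a * s)) (a * c)) k12.
have k12' : k1 ^+ 2 + (- k2) ^+ 2 = 1 by rewrite sqrrN.
have h2 := dist_linear k1 (- k2) (vec2 (b * s) (b * c)) (vec2 x y) k12'.
rewrite !vec2E in h1 h2; lra.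
Qed.

(** The difference of the squared distances to the origin and to (d0, d1) is affine along the
    segment and changes sign. *)
Lemma bisector_crossing (e0 e1 x y d0 d1 : R) :
  e0 ^+ 2 + e1 ^+ 2 < (e0 - d0) ^+ 2 + (e1 - d1) ^+ 2 ->
  (x - d0) ^+ 2 + (y - d1) ^+ 2 < x ^+ 2 + y ^+ 2 ->
  exists2 t, 0 < t < 1 &
    ((1 - t) * e0 + t * x) ^+ 2 + ((1 - t) * e1 + t * y) ^+ 2 =
    ((1 - t) * e0 + t * x - d0) ^+ 2 + ((1 - t) * e1 + t * y - d1) ^+ 2.
Proof.
move=> hE hD.
pose g0 := (e0 - d0) ^+ 2 + (e1 - d1) ^+ 2 - (e0 ^+ 2 + e1 ^+ 2).
pose g1 := x ^+ 2 + y ^+ 2 - ((x - d0) ^+ 2 + (y - d1) ^+ 2).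
have g00 : 0 < g0 by rewrite subr_gt0.
have g10 : 0 < g1 by rewrite subr_gt0.
have g : 0 < g0 + g1 by rewrite addr_gt0.
pose t := g0 / (g0 + g1); exists t.
  by rewrite divr_gt0 //= ltr_pdivrMr // mul1r ltrDl.
apply/eqP; rewrite -subr_eq0; apply/eqP.
transitivity (- (1 - t) * g0 + t * g1); first by rewrite /g0 /g1; ring.
by rewrite /t; field; rewrite gt_eqF.
Qed.

(** The squared norm is convex along the segment: having grown from e to z, it keeps growing towards
    (x, y). *)
Lemma crossing_inner (e0 e1 x y z0 z1 t : R) : 0 < t < 1 ->
  z0 = (1 - t) * e0 + t * x -> z1 = (1 - t) * e1 + t * y ->
  e0 ^+ 2 + e1 ^+ 2 < z0 ^+ 2 + z1 ^+ 2 -> z0 ^+ 2 + z1 ^+ 2 <= x * z0 + y * z1.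
Proof.
move=> /andP[t0 t1] E0 E1 lt.
have h : t * (z0 * (x - e0) + z1 * (y - e1)) =
    (z0 ^+ 2 + z1 ^+ 2 - (e0 ^+ 2 + e1 ^+ 2) + (z0 - e0) ^+ 2 + (z1 - e1) ^+ 2) / 2.
  by rewrite E0 E1; field.
have h0 : 0 <= t * (z0 * (x - e0) + z1 * (y - e1)).
  have h1 : 0 <= z0 ^+ 2 + z1 ^+ 2 - (e0 ^+ 2 + e1 ^+ 2) by rewrite subr_ge0 ltW.
  by rewrite h divr_ge0 //; do 2!(apply: addr_ge0; last exact: sqr_ge0).
rewrite pmulr_rge0 // in h0.
rewrite -subr_ge0; have -> : x * z0 + y * z1 - (z0 ^+ 2 + z1 ^+ 2) =
    (1 - t) * (z0 * (x - e0) + z1 * (y - e1)) by rewrite E0 E1; ring.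
by rewrite mulr_ge0 // subr_ge0 ltW.
Qed.

Lemma bisector_length (s c b z0 z1 : R) : s ^+ 2 + c ^+ 2 = 1 -> 0 < b ->
  z0 ^+ 2 + z1 ^+ 2 = (z0 - b * s) ^+ 2 + (z1 - b * c) ^+ 2 -> b = 2 * (s * z0 + c * z1).
Proof.
move=> u b0 H; apply: (mulfI (_ : b != 0)); first by rewrite gt_eqF.
have : b * b * (s ^+ 2 + c ^+ 2) = b * (2 * (s * z0 + c * z1)) by lra.
by rewrite u mulr1.
Qed.

Section MutualVertex.
Variables (s c a b x y r w : R).
Let A : 'rV[R]_2 := vec2 (- (a * s)) (a * c).
Let B : 'rV[R]_2 := vec2 0 0.
Let C : 'rV[R]_2 := vec2 (b * s) (b * c).
Let D : 'rV[R]_2 := vec2 x y.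
Let L := quad_perimeter A B C D.

Lemma mutual_straight : r ^+ 2 = 3 -> w ^+ 2 = 3 + 2 * r -> 0 < w ->
  s ^+ 2 + c ^+ 2 = 1 -> 1 / 2 < s -> s <= c ->
  1 <= 2 * s * c * a -> 1 <= 2 * s * c * b -> 0 <= x -> away D A B ->
  339 / 100 <= L \/ 4 / 3 * w <= L /\
  (L <= 4 / 3 * w -> [/\ w * s = r * c, 2 * s * c * a = 1, 2 * s * c * b = 1, x = 0 &
     y * (s * (3 - 4 * s ^+ 2)) = 1]).
Proof.
move=> r2 w2 w0 u s2 sc ha hb x0 /separation[p [q [pq hD hA]]].
have [_ _ a1 b1 _] := wide_facts s c a b u (ltW s2) sc ha hb.
have a0 : 0 <= a := le_trans ler01 a1.
have b0 : 0 <= b := le_trans ler01 b1.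
have pq' : (- p) ^+ 2 + q ^+ 2 = 1 by rewrite sqrrN.
apply: (kite_side_all s c a b x y (- p) q) => //.
- by apply: le_trans hA _; rewrite le_eqVlt; apply/orP; left; apply/eqP; ring.
- by rewrite opprK.
- by move=> k1 k2 k12; exact: perimeter_project.
Qed.

Lemma leg_lengths : s ^+ 2 + c ^+ 2 = 1 -> 0 <= a -> 0 <= b -> dist A B = a /\ dist B C = b.
Proof.
move=> u a0 b0; split; apply/eqP; rewrite -(@eqrXn2 _ 2) ?dist_ge0 // dist_vec2; apply/eqP.
  by rewrite -[RHS]mulr1 -u; ring.
by rewrite -[RHS]mulr1 -u; ring.
Qed.

Lemma mutual_bent : s ^+ 2 + c ^+ 2 = 1 -> 1 / 2 < s -> s <= c ->
  1 <= 2 * s * c * a -> 1 <= 2 * s * c * b -> 0 <= x ->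
  covers D A B C -> ~ away D A B -> 339 / 100 <= L.
Proof.
have h39 : 39 / 100 <= 1 / 2 :> R by lra.
move=> u s2 sc ha hb x0 cov nB.
have [scp _ a1 b1 _] := wide_facts s c a b u (ltW s2) sc ha hb.
have a0 : 0 <= a := le_trans ler01 a1.
have b0 : 0 <= b := le_trans ler01 b1.
have as2 : 1 / 2 <= a * s.
  by rewrite -[1 / 2]mul1r ler_pM ?divr_ge0 ?(ltW s2).
have ac2 : 1 / 2 <= a * c.
  by rewrite -[1 / 2]mul1r ler_pM ?divr_ge0 ?(le_trans (ltW s2) sc).
have [lAB lBC] := leg_lengths u a0 b0.
have [t t01 dE] : exists2 t, 0 <= t <= 1 & dist (lerp t A D) B < 1.
  have [t /andP[t0 t1] dE] := not_awayP _ _ _ nB; exists (1 - t); last by rewrite -lerpC.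
  by rewrite subr_ge0 t1 lerBlDr lerDl.
have cov' := coversC _ _ _ _ cov.
have cE : 1 <= dist (lerp t A D) C by case: (cov' t t01) => //; rewrite leNgt dE.
(* If D is no farther from B than from C, then CD >= 1, while AD has horizontal extent at least a s
   >= 1/2. *)
case: (lerP (dist D B) (dist D C)) => hD.
  have dDC : 1 <= dist D C.
    have := cov 0; rewrite lerp0 lexx ler01 => /(_ isT)[h|//]; exact: le_trans hD.
  have one : 1 ^+ 2 + 0 ^+ 2 = 1 :> R by ring.
  have := dist_linear 1 0 D A one; rewrite !vec2E mul1r mul0r addr0 opprK => dDA.
  rewrite /L /quad_perimeter lAB lBC (distC C D).
  clearbody A B C D; lra.
have hE : dist (lerp t A D) B ^+ 2 < dist (lerp t A D) C ^+ 2.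
  by apply: sqr_lt; [exact: dist_ge0 | exact: lt_le_trans cE].
have hD' : dist D C ^+ 2 < dist D B ^+ 2 by apply: sqr_lt => //; exact: dist_ge0.
rewrite /A /B /C /D !lerp_vec2 !dist_vec2 !subr0 in hE hD'.
have [v v01 eqX] := bisector_crossing _ _ _ _ _ _ hE hD'.
have dE2 : dist (lerp t A D) B ^+ 2 < 1.
  by rewrite -(expr1n _ 2); apply: sqr_lt => //; exact: dist_ge0.
rewrite /A /B /D lerp_vec2 dist_vec2 !subr0 in dE2.
set e0 := (1 - t) * _ + _ in hE hD' eqX dE2; set e1 := (1 - t) * (a * c) + _ in hE hD' eqX dE2.
have [X0 E0] : exists X0, X0 = (1 - v) * e0 + v * x by exists ((1 - v) * e0 + v * x).
have [X1 E1] : exists X1, X1 = (1 - v) * e1 + v * y by exists ((1 - v) * e1 + v * y).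
rewrite -E0 -E1 in eqX.
pose X := vec2 X0 X1.
have [m m01 XE] : exists2 m, 0 <= m <= 1 & X = lerp m A D.
  exists (1 - (1 - v) * (1 - t)).
    have [/andP[v0 v1] /andP[t0 t1]] := (v01, t01).
    rewrite subr_ge0 lerBlDr lerDl mulr_ge0 ?subr_ge0 // ?(ltW v1) // andbT.
    by rewrite mulr_ile1 ?subr_ge0 ?(ltW v1) // lerBlDr lerDl // ltW.
  by rewrite /X E0 E1 /A /D lerp_vec2; congr vec2; rewrite /e0 /e1; ring.
have dXX : dist X B = dist X C.
  apply/eqP; rewrite -(@eqrXn2 _ 2) ?dist_ge0 // /X /B /C !dist_vec2 !subr0.
  by rewrite eqX.
have dXC : 1 <= dist X C by case: (cov' m m01); rewrite -XE // dXX.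
have rho : 1 <= X0 ^+ 2 + X1 ^+ 2.
  by move: dXC; rewrite -dXX dist_ge1 dist_vec2 !subr0.
have cat := dist_lerp_cat A D m m01; rewrite -XE in cat.
have LX : a + b + dist A X + dist X C <= L.
  rewrite /L /quad_perimeter lAB lBC -(distC A D) -cat -!addrA !lerD2l.
  rewrite addrCA lerD2l distC addrC (distC X D) addrC.
  exact: dist_triangle.
(* Unless the perimeter is large, AX < 39/100. Both coordinates of A are at least 1/2 in absolute
   value, so X stays in the quadrant of A. *)
have [//|Lt] := lerP (339 / 100) L; suff : 339 / 100 <= L by rewrite leNgt Lt.
have dAX : dist A X < 39 / 100.
  rewrite -[ltLHS](addrK (3 : R)) -[ltRHS](addrK (3 : R)) ltrD2r.
  apply: le_lt_trans (_ : _ <= a + b + dist A X + dist X C) _.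
    have -> : dist A X + 3 = 1 + 1 + dist A X + 1 by ring.
    by rewrite !lerD.
  by apply: le_lt_trans LX _; apply: lt_le_trans Lt _;
  rewrite le_eqVlt; apply/orP; left; apply/eqP; field.
have one : 1 ^+ 2 + 0 ^+ 2 = 1 :> R by ring.
have one' : 0 ^+ 2 + 1 ^+ 2 = 1 :> R by ring.
have := dist_linear 1 0 X A one; rewrite !vec2E mul1r mul0r addr0 opprK distC => h0.
have := dist_linear 0 1 A X one'; rewrite !vec2E mul1r mul0r add0r => h1.
have X00 : X0 <= 0.
  have : X0 + a * s <= 1 / 2.
    by apply: le_trans h0 _; exact: le_trans (ltW dAX) h39.
  by move=> h; rewrite -(lerD2r (a * s)) add0r; exact: le_trans as2.
have X10 : 0 < X1.
  have h2 : a * c - X1 < 1 / 2.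
    by apply: le_lt_trans h1 _; exact: lt_le_trans dAX h39.
  by rewrite -(ltrN2 _ 0) oppr0 -(ltrD2l (a * c)) addr0; exact: lt_le_trans ac2.
have bE := bisector_length s c b X0 X1 u (lt_le_trans ltr01 b1) eqX.
have inner := crossing_inner _ _ _ _ _ _ _ v01 E0 E1 (lt_le_trans dE2 rho).
have yX : X0 ^+ 2 + X1 ^+ 2 <= y * X1.
  by apply: le_trans inner _; rewrite gerDr mulr_ge0_le0.
apply: (bent_side s c a b y X0 X1 L) => //.
  have := perimeter_project s c a b x y 1 0 u a0 b0 one.
  by rewrite !mulr0 mulr1 subr0 addr0.
have k37 : (35 / 37) ^+ 2 + (12 / 37) ^+ 2 = 1 :> R by field.
apply: le_trans (perimeter_project s c a b x y _ _ u a0 b0 k37).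
by rewrite le_eqVlt; apply/orP; left; apply/eqP; rewrite /lam; field.
Qed.

End MutualVertex.

End BisectorFrame.

(** * The angle at the mutual vertex and the extremal shape *)

Section AcuteVertex.
Context {R : realType}.
Implicit Types (A B C D : 'rV[R]_2) (a b c s x y p q r w l : R).

(* [s] and [c] are the sine and cosine of half the angle at [B]. *)
Lemma frame_bisector A B C : 0 < dist A B -> exists2 g, rigid g & exists s c,
  [/\ s ^+ 2 + c ^+ 2 = 1, 0 <= s, 0 <= c, g B = vec2 0 0 &
  g A = vec2 (- (dist A B * s)) (dist A B * c) /\
  g C = vec2 (dist B C * s) (dist B C * c)].
Proof.
move=> a0; have [g rg [gB gC h0]] := frame_axis B C A; have [dg _ _] := rg.
have aE : dist A B ^+ 2 = g A 0 0 ^+ 2 + g A 0 1 ^+ 2.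
  by rewrite -dg gB (vec2_eta (g A)) dist_vec2 !subr0 -vec2_eta.
move: (dist A B) a0 aE h0 (vec2_eta (g A)) => a a0.
move: (g A 0 0) (g A 0 1) => p h aE h0 gA.
have pa : p ^+ 2 <= a ^+ 2 by rewrite aE lerDl sqr_ge0.
have p1 : - a <= p <= a.
  by rewrite -ler_norml -(ger0_norm (ltW a0)); rewrite -ler_sqr ?nnegrE // !real_normK // num_real.
pose s := Num.sqrt ((1 - p / a) / 2); pose c := Num.sqrt ((1 + p / a) / 2).
have s2 : s ^+ 2 = (1 - p / a) / 2.
  rewrite sqr_sqrtr // divr_ge0 // subr_ge0 ler_pdivrMr // mul1r.
  by case/andP: p1.
have c2 : c ^+ 2 = (1 + p / a) / 2.
  rewrite sqr_sqrtr // divr_ge0 // -lerBlDl sub0r ler_pdivlMr // mulN1r.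
  by case/andP: p1.
have s0 : 0 <= s := sqrtr_ge0 _.
have c0 : 0 <= c := sqrtr_ge0 _.
have u : s ^+ 2 + c ^+ 2 = 1 by rewrite s2 c2; field; rewrite gt_eqF.
have pE : p = a * (c ^+ 2 - s ^+ 2) by rewrite s2 c2; field; rewrite gt_eqF.
have hE : h = a * (2 * s * c).
  apply/eqP; rewrite -(@eqrXn2 _ 2) ?mulr_ge0 ?(ltW a0) //; apply/eqP.
  have -> : (a * (2 * s * c)) ^+ 2 = 4 * a ^+ 2 * (s ^+ 2 * c ^+ 2) by ring.
  have -> : h ^+ 2 = a ^+ 2 - p ^+ 2 by rewrite aE; ring.
  by rewrite s2 c2; field; rewrite gt_eqF.
have rot : rigid (fun z => vec2 (s * z 0 0 - c * z 0 1) (c * z 0 0 + s * z 0 1)).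
  have u' : s ^+ 2 + (- c) ^+ 2 = 1 by rewrite sqrrN.
  have := rigid_motion s (- c) 1 (vec2 0 0) u' (expr1n _ 2).
  by congr rigid; apply/funext => z; rewrite !vec2E; congr vec2; ring.
exists ((fun z => vec2 (s * z 0 0 - c * z 0 1) (c * z 0 0 + s * z 0 1)) \o g).
  exact: (rigid_comp _ _ rot rg).
exists s, c; split=> //; first by rewrite /= gB !vec2E !mulr0 subr0 addr0.
split; rewrite /= ?gC ?gA !vec2E.
  rewrite pE hE; congr vec2.
    transitivity (- (a * s * (s ^+ 2 + c ^+ 2))); first by ring.
    by rewrite u mulr1.
  transitivity (a * c * (s ^+ 2 + c ^+ 2)); first by ring.
  by rewrite u mulr1.
by congr vec2; ring.
Qed.

(** The altitude from C on BA is b sin 2θ = 2 s c b, with foot at distance b cos 2θ from B. If the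
    foot falls beyond A, then b^2 >= AC^2 + a^2 instead. *)
Lemma leg_height s c a b : s ^+ 2 + c ^+ 2 = 1 -> 0 <= s -> 0 <= c -> 1 <= a -> 1 <= b ->
  0 <= c ^+ 2 - s ^+ 2 ->
  away (vec2 (- (a * s)) (a * c)) (vec2 0 0) (vec2 (b * s) (b * c)) ->
  1 <= 2 * s * c * b \/
  2 <= b ^+ 2.
Proof.
move=> u s0 c0 a1 b1 cs aw.
have a0 : 0 < a := lt_le_trans ltr01 a1.
have b0 : 0 < b := lt_le_trans ltr01 b1.
have AC := away_l _ _ _ aw; rewrite dist_ge1 dist_vec2 in AC.
have ACE : (- (a * s) - b * s) ^+ 2 + (a * c - b * c) ^+ 2 =
    a ^+ 2 + b ^+ 2 - 2 * a * b * (c ^+ 2 - s ^+ 2).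
  transitivity ((a ^+ 2 + b ^+ 2) * (s ^+ 2 + c ^+ 2) - 2 * a * b * (c ^+ 2 - s ^+ 2)).
    by ring.
  by rewrite u mulr1.
rewrite {}ACE in AC.
case: (lerP (b * (c ^+ 2 - s ^+ 2)) a) => foot; last first.
  right; have h : a * a <= a * (b * (c ^+ 2 - s ^+ 2)) by rewrite ler_pM2l // ltW.
  have a2 : 1 <= a ^+ 2 by rewrite -(expr1n _ 2); exact: sqr_le.
  by lra.
left; pose t := b * (c ^+ 2 - s ^+ 2) / a.
have t01 : 0 <= 1 - t <= 1.
  rewrite subr_ge0 lerBlDr lerDl /t ler_pdivrMr // mul1r foot divr_ge0 ?(ltW a0) //.
  by rewrite mulr_ge0 // ltW.
have := aw _ t01; rewrite lerp_vec2 dist_ge1 dist_vec2.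
have -> : ((1 - (1 - t)) * - (a * s) + (1 - t) * 0 - b * s) ^+ 2 +
  ((1 - (1 - t)) * (a * c) + (1 - t) * 0 - b * c) ^+ 2 = (2 * s * c * b) ^+ 2.
  have ta : t * a = b * (c ^+ 2 - s ^+ 2) by rewrite /t divfK // gt_eqF.
  transitivity ((t * a) ^+ 2 * (s ^+ 2 + c ^+ 2) + b ^+ 2 * (s ^+ 2 + c ^+ 2)
     - 2 * (t * a) * b * (c ^+ 2 - s ^+ 2)); first by ring.
  rewrite ta u; transitivity (b ^+ 2 * ((s ^+ 2 + c ^+ 2) ^+ 2 - (c ^+ 2 - s ^+ 2) ^+ 2)).
    by rewrite u; ring.
  by ring.
move=> h; apply: sqr_le_cancel; last by rewrite expr1n.
by rewrite !mulr_ge0 // ltW.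
Qed.

Lemma mirror_rigid : rigid (fun z : 'rV[R]_2 => vec2 (- z 0 0) (z 0 1)).
Proof.
have u : (-1) ^+ 2 + 0 ^+ 2 = 1 :> R by ring.
have e : (-1) ^+ 2 = 1 :> R by ring.
have := rigid_motion (-1) 0 (-1) (vec2 0 0) u e.
by congr rigid; apply/funext => z; rewrite !vec2E; congr vec2; ring.
Qed.

(** An obtuse angle at B, or a leg of length sqrt 2, already makes the triangle ABC too long. *)
Lemma acute_vertex s c a b : s ^+ 2 + c ^+ 2 = 1 -> 0 <= s -> 0 <= c -> 1 <= a -> 1 <= b ->
  let A := vec2 (- (a * s)) (a * c) in let C := vec2 (b * s) (b * c) in
  away A (vec2 0 0) C -> away (vec2 0 0) C A ->
  339 / 100 <= a + b + dist A C \/ [/\ s <= c, 1 <= 2 * s * c * a & 1 <= 2 * s * c * b].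
Proof.
move=> u s0 c0 a1 b1 A C awC awA.
have a2 : 1 <= a ^+ 2 by rewrite -(expr1n _ 2); exact: sqr_le.
have b2 : 1 <= b ^+ 2 by rewrite -(expr1n _ 2); exact: sqr_le.
have AC1 := away_l _ _ _ awC.
case: (lerP s c) => sc; last first.
  left; have : dist A C ^+ 2 = a ^+ 2 + b ^+ 2 + 2 * a * b * (s ^+ 2 - c ^+ 2).
    rewrite dist_vec2.
    transitivity ((a ^+ 2 + b ^+ 2) * (s ^+ 2 + c ^+ 2) + 2 * a * b * (s ^+ 2 - c ^+ 2)).
      by ring.
    by rewrite u mulr1.
  have : 0 <= 2 * a * b * (s ^+ 2 - c ^+ 2).
    apply: mulr_ge0; first by rewrite !mulr_ge0 // (le_trans ler01).
    by rewrite subr_ge0; apply: sqr_le => //; exact: ltW.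
  move: (dist A C) AC1 => d d1; clear awC awA A C sc s0 c0 u => h0 dE.
  have : 139 / 100 <= d by apply: sqr_le_cancel; lra.
  by lra.
have cs : 0 <= c ^+ 2 - s ^+ 2 by rewrite subr_ge0; exact: sqr_le.
have big (e : R) : 1 <= e -> 2 <= e ^+ 2 -> 139 / 100 <= e.
  by move=> e1 e2; apply: sqr_le_cancel; lra.
case: (leg_height s c a b u s0 c0 a1 b1 cs awC) => [hb|/(big _ b1) hb]; last first.
  by left; move: AC1 hb; clear - a1; lra.
have awA' : away (vec2 (- (b * s)) (b * c)) (vec2 0 0) (vec2 (a * s) (a * c)).
  have := (rigid_away _ (vec2 0 0) C A mirror_rigid).2 awA.
  rewrite !vec2E oppr0 opprK; exact: awayC.
case: (leg_height s c b a u s0 c0 b1 a1 cs awA') => [ha|/(big _ a1) ha]; last first.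
  by left; move: AC1 ha; clear - b1; lra.
by right.
Qed.

(** For r = sqrt 3 and w = sqrt (3 + 2 r), the two parts of the vertical diagonal of the kite. Since
    (2 r + 3) (2 r - 3) = r^2, the root sqrt (2 r - 3) of the lower part is r / w. *)
Definition kite_top r w : R := r * w / 3.
Definition kite_bottom r w : R := r / (3 * w).

(** The kite is upside down, with its top vertex at the origin; [l] is half of the diagonal AC. *)
Definition kite_config r w A B C D : Prop :=
  exists2 g, rigid g & exists2 l, 0 < l &
  [/\ g A = vec2 (- l) (l * kite_top r w), g B = vec2 0 0,
      g C = vec2 l (l * kite_top r w) & g D = vec2 0 (l * (kite_top r w + kite_bottom r w))].

Lemma kite_scalar s c a b y r w : r ^+ 2 = 3 -> w ^+ 2 = 3 + 2 * r -> 0 < w -> 0 < r ->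
  0 < s -> 0 < c -> s ^+ 2 + c ^+ 2 = 1 -> w * s = r * c ->
  2 * s * c * a = 1 -> 2 * s * c * b = 1 -> y * (s * (3 - 4 * s ^+ 2)) = 1 ->
  [/\ a = b, a * c = a * s * kite_top r w & y = a * s * (kite_top r w + kite_bottom r w)].
Proof.
move=> r2 w2 w0 r0 s0 c0 u ws ha hb hy.
have sc0 : 2 * s * c != 0 by rewrite gt_eqF // !mulr_gt0.
have ab : a = b by apply: (mulfI sc0); rewrite ha hb.
have cE : c = s * kite_top r w.
  rewrite /kite_top; have -> : s * (r * w / 3) = r * (w * s) / 3 by ring.
  rewrite ws; have -> : r * (r * c) / 3 = r ^+ 2 * c / 3 by ring.
  by rewrite r2; field.
split=> //; first by rewrite {1}cE mulrA.
have sE : s ^+ 2 * (3 + w ^+ 2) = 3.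
  have : (w * s) ^+ 2 = (r * c) ^+ 2 by rewrite ws.
  by rewrite !exprMn r2; lra.
have w4 : w ^+ 4 = 6 * w ^+ 2 + 3.
  have -> : w ^+ 4 = (w ^+ 2) ^+ 2 by rewrite -exprM.
  rewrite w2; have -> : (3 + 2 * r) ^+ 2 = 9 + 12 * r + 4 * r ^+ 2 by ring.
  by rewrite r2; ring.
have n0 : s * (3 - 4 * s ^+ 2) != 0.
  by apply/eqP => z; move: hy; rewrite z mulr0 => /esym/eqP; rewrite oner_eq0.
apply: (mulIf n0); rewrite hy.
have lE : a * s = r / (2 * w * s).
  apply: (mulfI (_ : 2 * c != 0)); first by rewrite mulf_neq0 ?pnatr_eq0 // gt_eqF.
  transitivity (1 : R); first by transitivity (2 * s * c * a) => //; ring.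
  have -> : 2 * c * (r / (2 * w * s)) = r * c / (w * s) by field; rewrite !gt_eqF.
  by rewrite -ws divff // mulf_neq0 ?gt_eqF.
rewrite lE /kite_top /kite_bottom.
have -> : r / (2 * w * s) * (r * w / 3 + r / (3 * w)) * (s * (3 - 4 * s ^+ 2)) =
  r ^+ 2 * ((w ^+ 2 + 1) * (3 - 4 * s ^+ 2)) / (6 * w ^+ 2) by field; rewrite !gt_eqF.
have -> : (w ^+ 2 + 1) * (3 - 4 * s ^+ 2) = 2 * w ^+ 2.
  have n3 : 3 + w ^+ 2 != 0 by rewrite gt_eqF // addr_gt0 // exprn_gt0.
  apply: (mulIf n3).
  have -> : (w ^+ 2 + 1) * (3 - 4 * s ^+ 2) * (3 + w ^+ 2) =
    (w ^+ 2 + 1) * (3 * (3 + w ^+ 2) - 4 * (s ^+ 2 * (3 + w ^+ 2))) by ring.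
  rewrite sE; have -> : (w ^+ 2 + 1) * (3 * (3 + w ^+ 2) - 4 * 3) = 3 * w ^+ 4 - 3 by ring.
  have -> : 2 * w ^+ 2 * (3 + w ^+ 2) = 6 * w ^+ 2 + 2 * w ^+ 4 by ring.
  by rewrite w4; ring.
by rewrite r2; field; rewrite gt_eqF.
Qed.

End AcuteVertex.

(** * The bound for a covered quadrilateral *)

Section VertexBound.
Context {R : realType}.
Implicit Types (A B C D : 'rV[R]_2) (a b c s x y p q l : R).
Variables (r w : R).
Hypotheses (r2 : r ^+ 2 = 3) (w2 : w ^+ 2 = 3 + 2 * r) (r0 : 0 < r) (w0 : 0 < w).

(** Reflection in the bisector exchanges A and C, so D may be taken with x >= 0, where AD is the
    side to study. *)
Lemma mutual_outcome s c a b x y : s ^+ 2 + c ^+ 2 = 1 -> 1 / 2 < s -> s <= c ->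
  1 <= 2 * s * c * a -> 1 <= 2 * s * c * b ->
  let A := vec2 (- (a * s)) (a * c) in let C := vec2 (b * s) (b * c) in
  let B := vec2 0 0 in let D := vec2 x y in let L := quad_perimeter A B C D in
  covers C D A B -> covers D A B C ->
  339 / 100 <= L \/ 4 / 3 * w <= L /\
  (L <= 4 / 3 * w -> [/\ w * s = r * c, 2 * s * c * a = 1, 2 * s * c * b = 1, x = 0 &
     y * (s * (3 - 4 * s ^+ 2)) = 1]).
Proof.
move=> u s2 sc ha hb A C B D L covC covD.
case: (lerP 0 x) => x0.
  have [aw|naw] := pselect (away D A B).
    exact: (mutual_straight s c a b x y r w).
  by left; apply: (mutual_bent s c a b x y).
have x0' : 0 <= - x by rewrite oppr_ge0 ltW.
have [mD mE _] := mirror_rigid (R := R).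
have mir z0 z1 : (fun z : 'rV[R]_2 => vec2 (- z 0 0) (z 0 1)) (vec2 z0 z1) = vec2 (- z0) z1.
  by rewrite !vec2E.
have covC' := (rigid_covers _ D C B A mirror_rigid).2 (coversC _ _ _ _ covC).
have awC' : away D C B -> away (vec2 (- x) y) (vec2 (- (b * s)) (b * c)) (vec2 0 0).
  by move=> /(rigid_away _ D C B mirror_rigid).2; rewrite !mir oppr0.
have LE : L = quad_perimeter (vec2 (- (b * s)) (b * c)) (vec2 0 0)
    (vec2 (a * s) (a * c)) (vec2 (- x) y).
  rewrite /L perimeter_rev -(rigid_perimeter _ C B A D mirror_rigid) !mir.
  by rewrite oppr0 opprK.
rewrite !mir oppr0 opprK in covC'.
rewrite LE.
have [aw|naw] := pselect (away D C B).
  have [|[H1 H2]] := mutual_straight s c b a (- x) y r w r2 w2 w0 u s2 sc hb ha x0' (awC' aw).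
    by left.
  by right; split=> // /H2[e1 e2 e3 e4 e5]; split=> //; rewrite -[x]opprK e4 oppr0.
left; apply: (mutual_bent s c b a (- x) y) => // aw'; apply: naw.
apply: (rigid_away _ D C B mirror_rigid).1.
by rewrite !mir oppr0.
Qed.

Lemma mutual_kite A B C D : covered A B C D -> away A B C -> away B C A ->
  339 / 100 <= quad_perimeter A B C D \/ 4 / 3 * w <= quad_perimeter A B C D /\
  (quad_perimeter A B C D <= 4 / 3 * w -> kite_config r w A B C D).
Proof.
case=> _ _ covC covD awA awC.
have a1 : 1 <= dist A B by rewrite distC; exact: away_l awC.
have b1 : 1 <= dist B C := away_r _ _ _ awA.
have [g rg [s [c [u s0 c0 gB [gA gC]]]]] := frame_bisector A B C (lt_le_trans ltr01 a1).
have {}awA := (rigid_away g A B C rg).2 awA.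
have {}awC := (rigid_away g B C A rg).2 awC.
have {}covC := (rigid_covers g C D A B rg).2 covC.
have {}covD := (rigid_covers g D A B C rg).2 covD.
have LE := rigid_perimeter g A B C D rg.
have gD := vec2_eta (g D).
have tri : dist A B + dist B C + dist (g A) (g C) <= quad_perimeter A B C D.
  have [dg _ _] := rg; rewrite dg /quad_perimeter.
  by have := dist_triangle D C A; rewrite (distC C A); lra.
rewrite gA gB gC in awA awC; rewrite gA gB gC gD in covC covD LE; rewrite gA gC in tri.
have [H|[sc ha hb]] := acute_vertex s c _ _ u s0 c0 a1 b1 awA awC.
  by left; exact: le_trans tri.
have [s1 c1] : 0 < s /\ 0 < c.
  have : 2 * s * c * dist A B != 0 by rewrite gt_eqF // (lt_le_trans ltr01).
  by rewrite !mulf_eq0 !negb_or !lt_neqAle s0 c0 !andbT ![0 == _]eq_sym =>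
    /andP[/andP[/andP[_ ->] ->]].
have a0 := dist_ge0 A B; have b0 := dist_ge0 B C.
case: (lerP s (1 / 2)) => s2.
  left; have one : 1 ^+ 2 + 0 ^+ 2 = 1 :> R by ring.
  have := perimeter_project s c _ _ (g D 0 0) (g D 0 1) _ _ u a0 b0 one.
  rewrite LE !mulr0 mulr1 subr0 addr0; apply: le_trans.
  by apply: (narrow_bound s c) => //; rewrite s1.
have [H|[H1 H2]] := mutual_outcome s c _ _ _ _ u s2 sc ha hb covC covD.
  by left; rewrite -LE.
right; rewrite -LE; split=> // /H2[ws ea eb ex ey].
have [ab ac ye] := kite_scalar s c _ _ _ r w r2 w2 w0 r0 s1 c1 u ws ea eb ey.
exists g => //; exists (dist A B * s); first by rewrite mulr_gt0 // (lt_le_trans ltr01).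
split=> //; first by rewrite gA ac.
  by rewrite gC -ab ac.
by rewrite gD ex ye.
Qed.

Lemma quadrilateral_bound A B C D : covered A B C D ->
  339 / 100 <= quad_perimeter A B C D \/ 4 / 3 * w <= quad_perimeter A B C D /\
  (quad_perimeter A B C D <= 4 / 3 * w ->
    (kite_config r w A B C D \/ kite_config r w B C D A) \/
    (kite_config r w C D A B \/ kite_config r w D A B C)).
Proof.
move=> cov; have covB := covered_rot _ _ _ _ cov; have covC := covered_rot _ _ _ _ covB.
have covD := covered_rot _ _ _ _ covC.
have E1 := perimeter_rot A B C D; have E2 := perimeter_rot B C D A.
have E3 := perimeter_rot C D A B.
case: (mutual_vertex _ _ _ _ cov) => [|[[[h h']|[h h']]|[[h h']|[h h']]]]; first by left.
- case: (mutual_kite _ _ _ _ cov h h') => [|[H1 H2]]; [by left | right; split=> // /H2; tauto].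
- rewrite E1; case: (mutual_kite _ _ _ _ covB h h') => [|[H1 H2]]; [by left | right].
  by split=> // /H2; tauto.
- rewrite E1 E2; case: (mutual_kite _ _ _ _ covC h h') => [|[H1 H2]]; [by left | right].
  by split=> // /H2; tauto.
- rewrite E1 E2 E3; case: (mutual_kite _ _ _ _ covD h h') => [|[H1 H2]]; [by left | right].
  by split=> // /H2; tauto.
Qed.

End VertexBound.

(** * From the boundary to the four sides *)

Section Covering.
Context {R : realType}.
Implicit Types (A B C D x y z : 'rV[R]_2) (v : 'I_4 -> 'rV[R]_2).

Definition far A B C D z : Prop :=
  1 <= dist z A \/ 1 <= dist z B \/ 1 <= dist z C \/ 1 <= dist z D.

Lemma dist_lerp_quadratic t A B C : dist (lerp t A B) C ^+ 2 =
  dist A B ^+ 2 * t ^+ 2 - 2 * t * ((B 0 0 - A 0 0) * (C 0 0 - A 0 0) +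
  (B 0 1 - A 0 1) * (C 0 1 - A 0 1)) + dist A C ^+ 2.
Proof. by rewrite !dist_sq !lerpE; ring. Qed.

Lemma dist_lerp_l t A B : 0 <= t -> dist (lerp t A B) A = t * dist A B.
Proof.
move=> t0; apply/eqP; rewrite -(@eqrXn2 _ 2) ?mulr_ge0 ?dist_ge0 //.
by rewrite exprMn !dist_sq !lerpE; apply/eqP; ring.
Qed.

(* The point of AB at distance 99/100 from A is far from some other vertex; if that vertex is C,
   which some later point of the side is close to, then AC is long. *)
Lemma receding_vertex A B C (t t' : R) : 0 <= t' < t -> t' * dist A B = 99 / 100 ->
  dist (lerp t A B) C < 1 -> 1 <= dist (lerp t' A B) C -> 14 / 10 <= dist A C.
Proof.
move=> tt e lt1 ge1.
have : dist (lerp t A B) C ^+ 2 < 1.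
  by rewrite -(expr1n _ 2); apply: sqr_lt => //; exact: dist_ge0.
have : 1 <= dist (lerp t' A B) C ^+ 2 by rewrite -dist_ge1.
have a2 : dist A B ^+ 2 * t' ^+ 2 = (99 / 100) ^+ 2 by rewrite -exprMn mulrC e.
rewrite !dist_lerp_quadratic a2.
set k := (B 0 0 - A 0 0) * (C 0 0 - A 0 0) + (B 0 1 - A 0 1) * (C 0 1 - A 0 1).
move: k => k h1 h2.
apply: sqr_le_cancel; first exact: dist_ge0.
have al : 0 <= dist A B ^+ 2 := sqr_ge0 _.
have h3 : (t - t') * (dist A B ^+ 2 * (t + t') - 2 * k) < 0 by lra.
have {}h3 : dist A B ^+ 2 * (t + t') - 2 * k < 0 by rewrite pmulr_rlt0 // in h3; lra.
have h4 : t' * (dist A B ^+ 2 * (t + t') - 2 * k) <= 0 by apply: mulr_ge0_le0; lra.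
have h5 : 0 <= dist A B ^+ 2 * (t' * (t - t')) by apply: mulr_ge0 => //; apply: mulr_ge0; lra.
by lra.
Qed.

Lemma covers_or_long A B C D :
  (forall t, 0 <= t <= 1 -> far A B C D (lerp t A B)) ->
  339 / 100 <= quad_perimeter A B C D \/ covers A B C D.
Proof.
have half A' B' C' D' t : (forall t, 0 <= t <= 1 -> far A' B' C' D' (lerp t A' B')) ->
    0 <= t <= 1 -> dist (lerp t A' B') C' < 1 -> dist (lerp t A' B') D' < 1 ->
    1 <= dist (lerp t A' B') A' -> 339 / 100 <= quad_perimeter A' B' C' D'.
  move=> {A B C D} {}H; move: A' B' C' D' H => A B C D H t01 dC dD dA.
  rewrite dist_lerp_l in dA; last by case/andP: t01.
  have AB0 : 0 < dist A B.
    rewrite lt_neqAle dist_ge0 andbT; apply/eqP => AB0.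
    by move: dA; rewrite -AB0 mulr0 ler10.
  have AB1 : 1 <= dist A B.
    by apply: le_trans dA _; rewrite ler_piMl ?dist_ge0 //; case/andP: t01.
  (* At distance 1 from A the far vertex could be A itself, so the point is taken slightly nearer;
     when its far vertex is C or D, the bound is exactly 99/100 + 1 + 14/10 = 339/100. *)
  pose t' := 99 / 100 / dist A B.
  have t'E : t' * dist A B = 99 / 100 by rewrite /t' divfK // gt_eqF.
  have t'0 : 0 <= t' by rewrite /t' divr_ge0 ?dist_ge0 // divr_ge0.
  have t't : t' < t.
    by rewrite -(ltr_pM2r AB0) t'E; apply: lt_le_trans dA; lra.
  have t'01 : 0 <= t' <= 1 by rewrite t'0 /= ltW // (lt_le_trans t't) //; case/andP: t01.
  have tt : 0 <= t' < t by rewrite t'0.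
  have cat := dist_lerp_cat A B t' t'01; rewrite distC dist_lerp_l // t'E in cat.
  have d1 := dist_triangle D A B; have d2 := dist_triangle C D B.
  have d3 := dist_triangle B (lerp t' A B) C; have d4 := dist_triangle D A C.
  have d5 := dist_triangle C (lerp t' A B) D.
  rewrite (distC C B) (distC D C) in d2; rewrite (distC D C) in d4.
  rewrite /quad_perimeter (distC D A); case: (H t' t'01) => [|[hB|[hC|hD]]].
  - by rewrite dist_lerp_l // t'E; lra.
  - by move: cat hB d1 d2; clear; lra.
  - have := receding_vertex _ _ _ _ _ tt t'E dC hC.
    by move: cat hC d3 d4; clear; lra.
  - have := receding_vertex _ _ _ _ _ tt t'E dD hD.
    by move: cat hD d3 d5; clear; lra.
move=> H; have [|] := pselect (covers A B C D); first by right.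
move=> /existsNP[t /not_implyP[t01 /not_orP[]]] /negP; rewrite -ltNge => dC /negP.
rewrite -ltNge => dD; left.
case: (H t t01) => [hA|[hB|[hC|hD]]].
- exact: half dC dD hA.
- rewrite perimeter_mirror -perimeter_rot -perimeter_rot.
  apply: (half _ _ _ _ (1 - t)); rewrite -?lerpC //.
    move=> u /andP[u0 u1]; rewrite lerpC.
    have := H (1 - u); rewrite subr_ge0 u1 lerBlDr lerDl u0 => /(_ isT).
    by rewrite /far; tauto.
  by case/andP: t01 => t0 t1; rewrite subr_ge0 t1 lerBlDr lerDl.
- by move: hC; rewrite leNgt dC.
- by move: hD; rewrite leNgt dD.
Qed.

Lemma covered_or_long A B C D :
  (forall t, 0 <= t <= 1 -> far A B C D (lerp t A B)) ->
  (forall t, 0 <= t <= 1 -> far A B C D (lerp t B C)) ->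
  (forall t, 0 <= t <= 1 -> far A B C D (lerp t C D)) ->
  (forall t, 0 <= t <= 1 -> far A B C D (lerp t D A)) ->
  339 / 100 <= quad_perimeter A B C D \/ covered A B C D.
Proof.
move=> hA hB hC hD.
case: (covers_or_long A B C D) => [//||cA]; first by left.
case: (covers_or_long B C D A) => [t /hB||cB];
  [by rewrite /far; tauto | by left; rewrite perimeter_rot |].
case: (covers_or_long C D A B) => [t /hC||cC];
  [by rewrite /far; tauto | by left; rewrite 2!perimeter_rot |].
case: (covers_or_long D A B C) => [t /hD||cD];
  [by rewrite /far; tauto | by left; rewrite -perimeter_rot |].
by right.
Qed.

End Covering.

Notation o0 := (@Ordinal 4 0 isT).
Notation o1 := (@Ordinal 4 1 isT).
Notation o2 := (@Ordinal 4 2 isT).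
Notation o3 := (@Ordinal 4 3 isT).

Lemma ord4_ind (Q : 'I_4 -> Prop) : Q o0 -> Q o1 -> Q o2 -> Q o3 -> forall i, Q i.
Proof.
move=> q0 q1 q2 q3 [[|[|[|[|k]]]] hk] //.
- by rewrite (_ : Ordinal hk = o0) //; apply/val_inj.
- by rewrite (_ : Ordinal hk = o1) //; apply/val_inj.
- by rewrite (_ : Ordinal hk = o2) //; apply/val_inj.
- by rewrite (_ : Ordinal hk = o3) //; apply/val_inj.
Qed.

Lemma ordS4 : [/\ ordS o0 = o1, ordS o1 = o2, ordS o2 = o3 & ordS o3 = o0].
Proof. by split; apply/val_inj. Qed.

(** * The radius seen from the vertices *)

Section Boundary.
Context {R : realType}.
Implicit Types (A B C D x y z : 'rV[R]_2) (v : 'I_4 -> 'rV[R]_2).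

Lemma segmentP x y z : segment x y z <-> exists2 t : R, 0 <= t <= 1 & z = lerp t x y.
Proof.
split=> [[t /= t01 <-]|[t t01 ->]].
  by exists t => //; move: t01; rewrite in_itv.
by exists t => //=; rewrite in_itv.
Qed.

Lemma boundaryP v z : boundary v z <->
  exists i, exists2 t : R, 0 <= t <= 1 & z = lerp t (v i) (v (ordS i)).
Proof.
split=> [[i _ /segmentP h]|[i /segmentP h]]; first by exists i.
by exists i.
Qed.

Lemma perimeterE v : perimeter v = quad_perimeter (v o0) (v o1) (v o2) (v o3).
Proof.
rewrite /perimeter !big_ord_recl big_ord0 addr0 /quad_perimeter !addrA.
by congr (_ + _ + _ + _); congr (dist (v _) (v _)); apply/val_inj.
Qed.

(** By convexity of the squared distance along a segment. This replaces the farthest point of the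
    boundary by a vertex. *)
Lemma far_vertex (e : R) x y z t : 0 <= t <= 1 -> e <= dist x (lerp t y z) ->
  e <= dist x y \/ e <= dist x z.
Proof.
move=> /andP[t0 t1] h; case: (lerP e (dist x y)) => hy; first by left.
case: (lerP e (dist x z)) => hz; first by right.
have e0 : 0 < e := le_lt_trans (dist_ge0 _ _) hy.
have h2 : e ^+ 2 <= dist x (lerp t y z) ^+ 2 by apply: sqr_le => //; exact: ltW.
have y2 : dist x y ^+ 2 < e ^+ 2 by apply: sqr_lt => //; exact: dist_ge0.
have z2 : dist x z ^+ 2 < e ^+ 2 by apply: sqr_lt => //; exact: dist_ge0.
have E := dist_lerp_sq t y z x.
have h3 : 0 <= t * (1 - t) * dist y z ^+ 2
  by apply: mulr_ge0; [apply: mulr_ge0; rewrite ?subr_ge0 | exact: sqr_ge0].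
have h4 : 0 <= (1 - t) * (e ^+ 2 - dist x y ^+ 2).
  by apply: mulr_ge0; rewrite subr_ge0 // ltW.
have h5 : 0 <= t * (e ^+ 2 - dist x z ^+ 2).
  by apply: mulr_ge0 => //; rewrite subr_ge0 ltW.
have h6 : 0 < (1 - t) * (e ^+ 2 - dist x y ^+ 2) + t * (e ^+ 2 - dist x z ^+ 2).
  have [t00|tn0] := eqVneq t 0; first by rewrite t00 subr0 mul1r mul0r addr0 subr_gt0.
  by rewrite ltr_wpDl // mulr_gt0 ?subr_gt0 // lt_neqAle eq_sym tn0.
by move: h2 E h3 h6; clear; lra.
Qed.

Lemma radius_far_vertex v z : boundary v z ->
  exists i, self_chebyshev_radius (boundary v) <= dist z (v i).
Proof.
have [x [y [_ _ -> _ H]]] :=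
  self_chebyshev_radius_attained (@boundary_compact R v) (@boundary_nonempty R v).
move=> /H[y' /boundaryP[i [t t01 ->]] le].
by case: (far_vertex _ _ _ _ _ t01 le) => h; [exists i | exists (ordS i)].
Qed.

Lemma radius_ge0 v : 0 <= self_chebyshev_radius (boundary v).
Proof.
have [x [y [_ _ -> _ _]]] :=
  self_chebyshev_radius_attained (@boundary_compact R v) (@boundary_nonempty R v).
exact: dist_ge0.
Qed.

Lemma radius_lower v (e : R) :
  (forall z, boundary v z -> exists2 y, boundary v y & e <= dist z y) ->
  e <= self_chebyshev_radius (boundary v).
Proof.
have [x [y [bx _ -> max _]]] :=
  self_chebyshev_radius_attained (@boundary_compact R v) (@boundary_nonempty R v).
by move=> /(_ x bx)[y' by' le]; apply: le_trans le (max _ by').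
Qed.

Lemma dist_scale (k : R) x y : 0 <= k -> dist (k *: x) (k *: y) = k * dist x y.
Proof.
move=> k0; apply/eqP; rewrite -(@eqrXn2 _ 2) ?mulr_ge0 ?dist_ge0 //.
by rewrite exprMn !dist_sq !mxE; apply/eqP; ring.
Qed.

Lemma lerp_scale (k : R) t x y : lerp t (k *: x) (k *: y) = k *: lerp t x y.
Proof. by rewrite /lerp scalerDr !scalerA; congr (_ *: _ + _ *: _); ring. Qed.

Lemma vertex_on_boundary v i : boundary v (v i).
Proof. by apply/boundaryP; exists i, 0; rewrite ?lexx ?ler01 ?lerp0. Qed.

Lemma quadrilateral_neq v i : is_quadrilateral v -> v i <> v (ordS i).
Proof.
move=> [_ _ flat] e; apply: (flat i); apply/segmentP; exists 0; first by rewrite lexx ler01.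
by rewrite lerp0 e.
Qed.

Lemma sqrt3_facts (r := Num.sqrt 3 : R) (w := Num.sqrt (3 + 2 * r)) :
  [/\ r ^+ 2 = 3, w ^+ 2 = 3 + 2 * r, 0 < r, 0 < w & 4 / 3 * w < 339 / 100].
Proof.
have r0 : 0 < r by rewrite sqrtr_gt0.
have r2 : r ^+ 2 = 3 by rewrite sqr_sqrtr.
have s0 : 0 < 3 + 2 * r by rewrite addr_gt0 // mulr_gt0.
have w0 : 0 < w by rewrite sqrtr_gt0.
have w2 : w ^+ 2 = 3 + 2 * r by rewrite sqr_sqrtr // ltW.
split=> //; move: r w r0 r2 {s0} w0 w2 => r w r0 r2 w0 w2.
(* A convergent of sqrt 3, with 97^2 = 3 * 56^2 + 1; the narrow gap between the optimal constant and
   339/100 demands this precision. *)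
have r1 : r <= 97 / 56.
  by apply: sqr_le_cancel; [lra | rewrite r2; lra].
suff : w < 1017 / 400 by lra.
rewrite ltNge; apply/negP => h.
have : (1017 / 400) ^+ 2 <= w ^+ 2 by apply: sqr_le; lra.
by rewrite w2; lra.
Qed.

End Boundary.

(** * The inequality and the shape in case of equality *)

Section Similarity.
Context {R : realType}.
Implicit Types (A B C D x y z : 'rV[R]_2) (v : 'I_4 -> 'rV[R]_2).
Let r : R := Num.sqrt 3.
Let w : R := Num.sqrt (3 + 2 * r).

Lemma kiteE : [/\ @kite R o0 = vec2 (- 1) 0, @kite R o1 = vec2 0 (kite_top r w),
  @kite R o2 = vec2 1 0 & @kite R o3 = vec2 0 (- kite_bottom r w)].
Proof.
have [r2 w2 r0 w0 _] := @sqrt3_facts R.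
split=> //; rewrite /kite /=; congr vec2.
  rewrite /kite_top mulrAC; congr (_ * _ / _).
  by rewrite /w addrC.
congr (- _); rewrite /kite_bottom.
have -> : Num.sqrt (2 * Num.sqrt 3 - 3) = r / w.
  apply/eqP; rewrite -(@eqrXn2 _ 2) ?sqrtr_ge0 ?divr_ge0 ?sqrtr_ge0 // sqr_sqrtr.
    rewrite expr_div_n r2 w2; apply/eqP; rewrite -/r.
    apply: (mulIf (_ : 3 + 2 * r != 0)); first by rewrite gt_eqF // addr_gt0 // mulr_gt0.
    rewrite divfK; last by rewrite gt_eqF // addr_gt0 // mulr_gt0.
    transitivity (4 * r ^+ 2 - 9); first by ring.
    by rewrite r2; ring.
  rewrite subr_ge0; apply: sqr_le_cancel; first by rewrite mulr_ge0 // sqrtr_ge0.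
  by rewrite exprMn r2; lra.
by field; rewrite gt_eqF.
Qed.

Lemma boundary_rot v k : boundary (fun i => v (iter k (@ordS 4) i)) = boundary v.
Proof.
apply/seteqP; split=> z /boundaryP[i [t t01 ->]]; apply/boundaryP.
  by exists (iter k (@ordS 4) i), t => //; congr lerp; rewrite -iterSr.
have /existsP[j /eqP <-] : [exists j, iter k (@ordS 4) j == i].
  elim: k i => [|k IH] i /=; first by apply/existsP; exists i.
  have /existsP[j /eqP E] := IH (ord_pred i); apply/existsP; exists j.
  by rewrite E ord_predK.
by exists j, t => //; congr lerp; rewrite -iterSr.
Qed.

Lemma boundary_image (f : 'rV[R]_2 -> 'rV[R]_2) v :
  (forall t x y, 0 <= t <= 1 -> f (lerp t x y) = lerp t (f x) (f y)) ->
  boundary (f \o v) = [set f z | z in boundary v]%classic.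
Proof.
move=> fl; apply/seteqP; split=> z.
  move=> /boundaryP[i [t t01 ->]]; exists (lerp t (v i) (v (ordS i))); last by rewrite fl.
  by apply/boundaryP; exists i, t.
move=> [y /boundaryP[i [t t01 ->]] <-]; apply/boundaryP.
by exists i, t => //; rewrite fl.
Qed.

Lemma kite_similarity (e : R) A B C D : 0 < e ->
  kite_config r w (e^-1 *: A) (e^-1 *: B) (e^-1 *: C) (e^-1 *: D) ->
  exists f, [/\ is_similarity f, forall t x y, f (lerp t x y) = lerp t (f x) (f y) &
    [/\ f (kite o0) = A, f (kite o1) = B, f (kite o2) = C & f (kite o3) = D]].
Proof.
move=> e0 [g [dg lg [g' g'K]] [l l0 [gA gB gC gD]]].
have gK x : g' (g x) = x by apply: dist_eq0; rewrite -dg g'K distxx.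
have dg' x y : dist (g' x) (g' y) = dist x y by rewrite -dg !g'K.
have lg' t x y : g' (lerp t x y) = lerp t (g' x) (g' y).
  by apply: (can_inj gK); rewrite lg !g'K.
(* Turns the kite upside down, top vertex to the origin, as [kite_config] has it. *)
pose h (z : 'rV[R]_2) : 'rV[R]_2 := vec2 (l * z 0 0) (l * (kite_top r w - z 0 1)).
have dh x y : dist (h x) (h y) = l * dist x y.
  apply/eqP; rewrite -(@eqrXn2 _ 2) ?mulr_ge0 ?dist_ge0 ?(ltW l0) //.
  by rewrite dist_vec2 exprMn dist_sq; apply/eqP; ring.
have lh t x y : h (lerp t x y) = lerp t (h x) (h y).
  by rewrite /h lerp_vec2 !lerpE; congr vec2; ring.
have scK x : e *: (e^-1 *: x) = x by rewrite scalerA divff ?scale1r // gt_eqF.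
exists (fun z => e *: g' (h z)); split.
- exists (e * l); first by rewrite mulr_gt0.
  by move=> x y; rewrite dist_scale ?(ltW e0) // dg' dh mulrA.
- by move=> t x y; rewrite lh lg' lerp_scale.
have [-> -> -> ->] := kiteE; rewrite /h !vec2E.
split.
- by rewrite -(scK A) -(gK (e^-1 *: A)) gA; congr (_ *: g' _); congr vec2; ring.
- by rewrite -(scK B) -(gK (e^-1 *: B)) gB; congr (_ *: g' _); congr vec2; ring.
- by rewrite -(scK C) -(gK (e^-1 *: C)) gC; congr (_ *: g' _); congr vec2; ring.
- by rewrite -(scK D) -(gK (e^-1 *: D)) gD; congr (_ *: g' _); congr vec2; ring.
Qed.

Lemma equality_kite v : is_quadrilateral v ->
  0 < self_chebyshev_radius (boundary v) ->
  (exists k, let u i := (self_chebyshev_radius (boundary v))^-1 *: v (iter k (@ordS 4) i) in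
    kite_config r w (u o0) (u o1) (u o2) (u o3)) -> is_magic_kite v.
Proof.
move=> qv e0 [k cfg]; split=> //.
have [f [sf lf [f0 f1 f2 f3]]] := kite_similarity _ _ _ _ _ e0 cfg.
exists f => //; rewrite -(boundary_rot v k) -(boundary_image _ _ (fun t x y _ => lf t x y)).
congr boundary; apply/funext; exact: ord4_ind.
Qed.

Lemma isoperimetric v : is_quadrilateral v ->
  let c := 4 / 3 * w * self_chebyshev_radius (boundary v) in
  c <= perimeter v /\ (perimeter v = c -> is_magic_kite v).
Proof.
move=> qv; have [r2 w2 r0 w0 wb] := @sqrt3_facts R; rewrite -/r -/w in r2 w2 r0 w0 wb.
have := radius_ge0 v; have := equality_kite v qv; have := radius_far_vertex v.
move: (self_chebyshev_radius (boundary v)) => e far_e mk e0; cbv zeta.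
(* A zero radius cannot be scaled to 1; equality would then mean zero perimeter, which distinct
   consecutive vertices forbid. *)
have [e00|en0] := eqVneq e 0.
  rewrite e00 mulr0; split; first by rewrite /perimeter sumr_ge0 // => i _; exact: dist_ge0.
  rewrite perimeterE /quad_perimeter => p0; exfalso.
  have := dist_ge0 (v o0) (v o1); have := dist_ge0 (v o1) (v o2).
  have := dist_ge0 (v o2) (v o3); have := dist_ge0 (v o3) (v o0) => h1 h2 h3 h4.
  apply: (quadrilateral_neq v o0 qv); have [-> _ _ _] := ordS4; apply: dist_eq0; lra.
have {}e0 : 0 < e by rewrite lt_neqAle eq_sym en0.
have ei : 0 <= e^-1 by rewrite invr_ge0 ltW.
pose u i := e^-1 *: v i.
have du i j : dist (u i) (u j) = e^-1 * dist (v i) (v j) by rewrite dist_scale.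
have pu : perimeter v = e * quad_perimeter (u o0) (u o1) (u o2) (u o3).
  rewrite perimeterE /quad_perimeter !du -!mulrDr mulrA divff ?gt_eqF //.
  by rewrite mul1r.
have side i t : 0 <= t <= 1 -> far (u o0) (u o1) (u o2) (u o3) (lerp t (u i) (u (ordS i))).
  move=> t01; have [|j] := far_e (lerp t (v i) (v (ordS i))).
    by apply/boundaryP; exists i, t.
  have one x : e <= dist x (v j) -> 1 <= dist (e^-1 *: x) (u j).
    by move=> h; rewrite dist_scale // mulrC ler_pdivlMr // mul1r.
  rewrite lerp_scale => /one; rewrite /far.
  by move: j {one}; apply: ord4_ind; tauto.
have [S0 S1 S2 S3] := ordS4.
have s0 := side o0; have s1 := side o1; have s2 := side o2; have s3 := side o3.
rewrite S0 in s0; rewrite S1 in s1; rewrite S2 in s2; rewrite S3 in s3.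
have strict : 339 / 100 <= quad_perimeter (u o0) (u o1) (u o2) (u o3) ->
    4 / 3 * w * e < perimeter v.
  by move=> h; rewrite pu [ltLHS]mulrC ltr_pM2l //; exact: lt_le_trans h.
case: (covered_or_long _ _ _ _ s0 s1 s2 s3) => [/strict lt|cov].
  by split; [exact: ltW | move=> E; rewrite E ltxx in lt].
case: (quadrilateral_bound r w r2 w2 r0 w0 _ _ _ _ cov) => [/strict lt|[H1 H2]].
  by split; [exact: ltW | move=> E; rewrite E ltxx in lt].
split; first by rewrite pu [leLHS]mulrC ler_pM2l.
rewrite pu [RHS]mulrC => /(mulfI (lt0r_neq0 e0)) E.
apply: mk => //; case: H2; first by rewrite E.
  by case=> K; [exists 0%N | exists 1%N]; rewrite /= ?S0 ?S1 ?S2 ?S3.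
by case=> K; [exists 2%N | exists 3%N]; rewrite /= ?S0 ?S1 ?S2 ?S3 ?S0 ?S1 ?S2 ?S3 ?S0.
Qed.

End Similarity.

(** * The perimeter of a magic kite *)

Section Converse.
Context {R : realType}.
Implicit Types (A B C D x y z : 'rV[R]_2) (v : 'I_4 -> 'rV[R]_2).

(** A point is determined by its distances t d and (1 - t) d to the ends of a segment of length
    d. *)
Lemma similarity_lerp (f : 'rV[R]_2 -> 'rV[R]_2) (k : R) :
  (forall x y, dist (f x) (f y) = k * dist x y) ->
  forall t x y, 0 <= t <= 1 -> f (lerp t x y) = lerp t (f x) (f y).
Proof.
move=> df t x y t01; apply: dist_eq0; apply/eqP; rewrite -sqrf_eq0.
rewrite dist_lerp_sq !df; have /andP[t0 t1] := t01.
rewrite (distC (lerp t x y) y) (lerpC t) (distC y) !dist_lerp_l ?subr_ge0 //.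
rewrite -lerpC dist_lerp_l // (distC y x); apply/eqP; ring.
Qed.

(** With q0, q2 and q1, q3 never consecutive, only rotations and reversals of the given order
    remain, and they keep the perimeter. *)
Lemma cyclic_order v (q0 q1 q2 q3 : 'rV[R]_2) :
  q0 <> q1 -> q0 <> q2 -> q0 <> q3 -> q1 <> q2 -> q1 <> q3 -> q2 <> q3 ->
  (exists i, v i = q0) -> (exists i, v i = q1) -> (exists i, v i = q2) ->
  (exists i, v i = q3) ->
  (forall i, v i = q0 -> v (ordS i) = q2 -> False) ->
  (forall i, v i = q2 -> v (ordS i) = q0 -> False) ->
  (forall i, v i = q1 -> v (ordS i) = q3 -> False) ->
  (forall i, v i = q3 -> v (ordS i) = q1 -> False) ->
  perimeter v = quad_perimeter q0 q1 q2 q3.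
Proof.
move=> n01 n02 n03 n12 n13 n23 [i0 h0] [i1 h1] [i2 h2] [i3 h3] d02 d20 d13 d31.
have [S0 S1 S2 S3] := ordS4.
have some i q : v i = q -> v o0 = q \/ v o1 = q \/ v o2 = q \/ v o3 = q.
  by move: i; apply: ord4_ind; tauto.
have {h0} h0 := some _ _ h0; have {h1} h1 := some _ _ h1.
have {h2} h2 := some _ _ h2; have {h3} h3 := some _ _ h3.
have := d02 o3; have := d02 o2; have := d02 o1; have {d02} := d02 o0.
have := d20 o3; have := d20 o2; have := d20 o1; have {d20} := d20 o0.
have := d13 o3; have := d13 o2; have := d13 o1; have {d13} := d13 o0.
have := d31 o3; have := d31 o2; have := d31 o1; have {d31} := d31 o0.
rewrite perimeterE S0 S1 S2 S3 {some S0 S1 S2 S3}.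
move: (v o0) (v o1) (v o2) (v o3) h0 h1 h2 h3 => a b c d h0 h1 h2 h3.
have c01 := distC q0 q1; have c12 := distC q1 q2; have c23 := distC q2 q3.
have c30 := distC q3 q0.
intros; case: h0 => [e0|[e0|[e0|e0]]];
(case: h1 => [e1|[e1|[e1|e1]]]; try (exfalso; congruence));
(case: h2 => [e2|[e2|[e2|e2]]]; try (exfalso; solve [congruence | eauto 3]));
(case: h3 => [e3|[e3|[e3|e3]]]; try (exfalso; solve [congruence | eauto 3]));
rewrite e0 e1 e2 e3 /quad_perimeter; clear -c01 c12 c23 c30; lra.
Qed.

Lemma kite_shape : exists T b : R, [/\ 0 < T, 0 < b,
  [/\ @kite R o0 = vec2 (- 1) 0, @kite R o1 = vec2 0 T, @kite R o2 = vec2 1 0 &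
     @kite R o3 = vec2 0 (- b)] &
  [/\ T = Num.sqrt 3 * Num.sqrt (3 + 2 * Num.sqrt 3) / 3, T * b = 1 / 3 &
      T ^+ 2 = (3 + 2 * Num.sqrt 3) / 3]].
Proof.
have [r2 w2 r0 w0 _] := @sqrt3_facts R; have K := @kiteE R.
move: (Num.sqrt 3) (Num.sqrt (3 + 2 * Num.sqrt 3)) r2 w2 r0 w0 K => r w r2 w2 r0 w0 K.
exists (kite_top r w), (kite_bottom r w); split=> //.
- by rewrite /kite_top divr_gt0 // mulr_gt0.
- by rewrite /kite_bottom divr_gt0 // mulr_gt0.
split=> //.
  have -> : kite_top r w * kite_bottom r w = r ^+ 2 / 9.
    by rewrite /kite_top /kite_bottom; field; rewrite gt_eqF.
  by rewrite r2; field.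
have -> : kite_top r w ^+ 2 = r ^+ 2 * w ^+ 2 / 9 by rewrite /kite_top; field.
by rewrite r2 w2; field.
Qed.

Lemma kite_sides (T b : R) z : [/\ @kite R o0 = vec2 (- 1) 0, @kite R o1 = vec2 0 T,
     @kite R o2 = vec2 1 0 & @kite R o3 = vec2 0 (- b)] -> boundary kite z ->
  exists2 t : R, 0 <= t <= 1 &
    (z = vec2 (t - 1) (t * T) \/ z = vec2 (1 - t) (t * T)) \/
    (z = vec2 (1 - t) (- (t * b)) \/ z = vec2 (t - 1) (- (t * b))).
Proof.
move=> [K0 K1 K2 K3] /boundaryP[i [t t01 ->]]; have [S0 S1 S2 S3] := ordS4.
have t01' : 0 <= 1 - t <= 1 by lra.
move: i; apply: ord4_ind; rewrite ?S0 ?S1 ?S2 ?S3 ?K0 ?K1 ?K2 ?K3 lerp_vec2.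
- by exists t => //; left; left; congr vec2; ring.
- by exists (1 - t) => //; left; right; congr vec2; ring.
- by exists t => //; right; left; congr vec2; ring.
- by exists (1 - t) => //; right; right; congr vec2; ring.
Qed.

Lemma kite_side_bounds (T b t x y : R) : 0 < T -> 0 < b -> 0 <= t <= 1 ->
  x = t - 1 \/ x = 1 - t -> y = t * T \/ y = - (t * b) ->
  [/\ -1 <= x <= 1, - b <= y <= T, (x = -1 -> y = 0) /\ (x = 1 -> y = 0),
      (y = T -> x = 0) /\ (y = - b -> x = 0) & x = 0 -> y = T \/ y = - b].
Proof.
move=> T0 b0 t01 hx hy.
have tT : 0 <= t * T <= T by rewrite mulr_ge0 ?ler_piMl ?(ltW T0) //; case/andP: t01.
have tb : 0 <= t * b <= b by rewrite mulr_ge0 ?ler_piMl ?(ltW b0) //; case/andP: t01.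
have t0 : t = 0 -> y = 0 by move=> e; case: hy => ->; rewrite e mul0r ?oppr0.
have t1 : t = 1 -> x = 0 by move=> e; case: hx => ->; lra.
split.
- by case: hx => ->; lra.
- by case: hy => ->; lra.
- by split=> e; apply: t0; case: hx; lra.
- split=> e; apply: t1; case: hy => hy; try by exfalso; lra.
    by apply: (mulIf (lt0r_neq0 T0)); rewrite mul1r -hy.
  by apply: (mulIf (lt0r_neq0 b0)); rewrite mul1r; lra.
- move=> e; have e1 : t = 1 by case: hx; lra.
  by case: hy => ->; [left|right]; rewrite e1 mul1r.
Qed.

Lemma kite_boundary_bounds (T b : R) z : 0 < T -> 0 < b ->
  [/\ @kite R o0 = vec2 (- 1) 0, @kite R o1 = vec2 0 T,
     @kite R o2 = vec2 1 0 & @kite R o3 = vec2 0 (- b)] -> boundary kite z ->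
  [/\ -1 <= z 0 0 <= 1, - b <= z 0 1 <= T,
      (z 0 0 = -1 -> z = kite o0) /\ (z 0 0 = 1 -> z = kite o2),
      (z 0 1 = T -> z = kite o1) /\ (z 0 1 = - b -> z = kite o3) &
      z 0 0 = 0 -> z 0 1 = T \/ z 0 1 = - b].
Proof.
move=> T0 b0 K bz; have [t t01 H] := kite_sides T b z K bz; have [-> -> -> ->] := K.
have hx : z 0 0 = t - 1 \/ z 0 0 = 1 - t.
  by case: H => [[]|[]] ->; rewrite vec2E; [left|right|right|left].
have hy : z 0 1 = t * T \/ z 0 1 = - (t * b).
  by case: H => [[]|[]] ->; rewrite vec2E; [left|left|right|right].
have [h1 h2 [h3 h3'] [h4 h4'] h5] := kite_side_bounds _ _ _ _ _ T0 b0 t01 hx hy.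
split=> //; split=> e; rewrite [z]vec2_eta.
- by rewrite (h3 e) e.
- by rewrite (h3' e) e.
- by rewrite (h4 e) e.
- by rewrite (h4' e) e.
Qed.

Lemma extreme_combination (t u v m : R) : 0 <= t <= 1 -> m <= u -> m <= v ->
  m = (1 - t) * u + t * v -> u = m \/ v = m.
Proof.
move=> /andP[t0 t1] mu mv E; case: (ltrP m u) => hu; last by left; lra.
case: (ltrP m v) => hv; last by right; lra.
exfalso; have h1 : 0 <= (1 - t) * (u - m) by apply: mulr_ge0; lra.
have h2 : 0 <= t * (v - m) by apply: mulr_ge0; lra.
have e1 : (1 - t) * (u - m) = 0 by lra.
have e2 : t * (v - m) = 0 by lra.
move/eqP: e1; rewrite mulf_eq0 => /orP[/eqP e|/eqP]; last by lra.
by move/eqP: e2; rewrite mulf_eq0 => /orP[/eqP|/eqP]; lra.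
Qed.

(** Each vertex is the only boundary point where a certain coordinate attains its minimum or
    maximum. *)
Lemma kite_extreme j x y (t : R) : boundary kite x -> boundary kite y -> 0 <= t <= 1 ->
  kite j = lerp t x y -> x = kite j \/ y = kite j.
Proof.
have [T [b [T0 b0 K _]]] := kite_shape.
move=> /(kite_boundary_bounds T b _ T0 b0 K)[x0 x1 [xK0 xK2] [xK1 xK3] _].
move=> /(kite_boundary_bounds T b _ T0 b0 K)[y0 y1 [yK0 yK2] [yK1 yK3] _] t01 E.
have E0 : kite j 0 0 = (1 - t) * x 0 0 + t * y 0 0 by rewrite E lerpE.
have E1 : kite j 0 1 = (1 - t) * x 0 1 + t * y 0 1 by rewrite E lerpE.
move: j E0 E1 {E}; have [K0 K1 K2 K3] := K.
apply: ord4_ind; rewrite ?K0 ?K1 ?K2 ?K3 !vec2E -?K0 -?K1 -?K2 -?K3 => E0 E1.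
- case: (extreme_combination t (x 0 0) (y 0 0) (-1) t01) => [||//|/xK0|/yK0];
    [lra|lra|by left|by right].
- case: (extreme_combination t (- x 0 1) (- y 0 1) (- T) t01) => [|||/oppr_inj/xK1|/oppr_inj/yK1];
    [lra|lra|lra|by left|by right].
- case: (extreme_combination t (- x 0 0) (- y 0 0) (- 1) t01) => [|||/oppr_inj/xK2|/oppr_inj/yK2];
    [lra|lra|lra|by left|by right].
- case: (extreme_combination t (x 0 1) (y 0 1) (- b) t01) => [||//|/xK3|/yK3];
    [lra|lra|by left|by right].
Qed.

(** Both midpoints lie on the second axis strictly between [kite o3] and [kite o1], the only
    boundary points on that axis. *)
Lemma kite_no_diagonal j : ~ boundary kite (lerp (1 / 2 : R) (kite j) (kite (ordS (ordS j)))).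
Proof.
have [T [b [T0 b0 K _]]] := kite_shape; have [S0 S1 S2 S3] := ordS4.
have [K0 K1 K2 K3] := K.
have ne0 : T + b != 0 by rewrite gt_eqF // addr_gt0.
move: j; apply: ord4_ind; rewrite ?S0 ?S1 ?S2 ?S3 ?S0;
  move=> /(kite_boundary_bounds T b _ T0 b0 K)[_ _ _ _];
  rewrite !lerpE ?K0 ?K1 ?K2 ?K3 !vec2E; case; lra.
Qed.

Lemma kite_distinct : [/\ @kite R o0 <> kite o1, @kite R o0 <> kite o2 & @kite R o0 <> kite o3] /\
  [/\ @kite R o1 <> kite o2, @kite R o1 <> kite o3 & @kite R o2 <> kite o3].
Proof.
have [T [b [T0 b0 [-> -> -> ->] _]]] := kite_shape.
have c0 (p q p' q' : R) : vec2 p q = vec2 p' q' -> p = p'.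
  by move=> /(congr1 (fun z : 'rV[R]_2 => z 0 0)); rewrite !vec2E.
have c1 (p q p' q' : R) : vec2 p q = vec2 p' q' -> q = q'.
  by move=> /(congr1 (fun z : 'rV[R]_2 => z 0 1)); rewrite !vec2E.
by split; split; do [move=> /c0; lra | move=> /c1; lra].
Qed.

Lemma kite_far : exists rho : R,
  4 / 3 * Num.sqrt (3 + 2 * Num.sqrt 3) * rho = perimeter kite /\
  forall z, boundary kite z -> exists j, rho <= dist z (kite j).
Proof.
have [r2 w2 r0 w0 _] := @sqrt3_facts R.
have [T [b [T0 b0 K [TE Tb T2]]]] := kite_shape; have [K0 K1 K2 K3] := K.
move: (Num.sqrt 3) (Num.sqrt (3 + 2 * Num.sqrt 3)) r2 w2 r0 w0 TE T2 => r w r2 w2 r0 w0 TE T2.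
have b2 : b ^+ 2 = (2 * r - 3) / 9.
  have q0 : (3 + 2 * r) / 3 != 0 by rewrite gt_eqF // divr_gt0 // addr_gt0 // mulr_gt0.
  apply: (mulIf q0); rewrite -{1}T2 -exprMn mulrC Tb.
  transitivity ((4 * r ^+ 2 - 9) / 27); last by field.
  by rewrite r2; field.
pose m := dist (@kite R o0) (kite o1).
have m2 : m ^+ 2 = 1 + T ^+ 2 by rewrite /m K0 K1 dist_vec2; ring.
have m0 : 0 < m.
  rewrite lt_neqAle dist_ge0 andbT; apply/eqP => e; move: m2; rewrite -e expr0n /=.
  by have := sqr_ge0 T; lra.
pose n := dist (@kite R o2) (kite o3).
have n2 : n ^+ 2 = 1 + b ^+ 2 by rewrite /n K2 K3 dist_vec2; ring.
have mn : m = n * r.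
  apply/eqP; rewrite -(@eqrXn2 _ 2) ?mulr_ge0 ?dist_ge0 ?(ltW r0) //; apply/eqP.
  by rewrite exprMn m2 n2 T2 b2 r2; field.
have per : perimeter kite = 2 * m + 2 * n.
  rewrite perimeterE /quad_perimeter -/m -/n.
  have -> : dist (@kite R o1) (kite o2) = m.
    apply/eqP; rewrite -(@eqrXn2 _ 2) ?dist_ge0 ?(ltW m0) // m2 K1 K2 dist_vec2; apply/eqP; ring.
  have -> : dist (@kite R o3) (kite o0) = n.
    apply/eqP; rewrite -(@eqrXn2 _ 2) ?dist_ge0 // n2 K0 K3 dist_vec2; apply/eqP; ring.
  by ring.
(* The altitude of the triangle [kite o0], [kite o1], [kite o2] on a side of length [m]: it bounds
   the distance from an upper side to the opposite end of the horizontal diagonal. *)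
exists (2 * T / m); split.
  apply: (mulIf (lt0r_neq0 m0)).
  have -> : 4 / 3 * w * (2 * T / m) * m = 8 / 3 * w * T by field; rewrite gt_eqF.
  have -> : 8 / 3 * w * T = 8 / 9 * r * w ^+ 2 by rewrite TE; field.
  have -> : perimeter kite * m = 2 * m ^+ 2 + 2 * (n * r) * n by rewrite per -mn; ring.
  have -> : 2 * (n * r) * n = 2 * r * n ^+ 2 by ring.
  rewrite m2 n2 T2 b2 w2.
  transitivity (8 / 3 * r + 16 / 9 * r ^+ 2); first by field.
  transitivity (4 + 4 / 3 * r + (4 / 3) * r + 4 / 9 * r ^+ 2); last by field.
  by rewrite r2; field.
have far4 z j : 4 * T ^+ 2 <= dist z (kite j) ^+ 2 * (1 + T ^+ 2) ->
    2 * T / m <= dist z (kite j).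
  move=> h; rewrite ler_pdivrMr //; apply: sqr_le_cancel.
    by rewrite mulr_ge0 ?dist_ge0 // ltW.
  by rewrite !exprMn m2; apply: le_trans h; rewrite -natrX.
have low (z : R) : (1 + b ^+ 2) * (4 * T ^+ 2) <= (1 + b ^+ 2) * (z * (1 + T ^+ 2)) ->
    4 * T ^+ 2 <= z * (1 + T ^+ 2).
  by rewrite ler_pM2l // ltr_wpDr // sqr_ge0.
(* The distance (T + b) / n from [kite o1] to the lines of the lower sides is the same 2 T / m. *)
have Tb2 : (1 + b ^+ 2) * (4 * T ^+ 2) = (T + b) ^+ 2 * (1 + T ^+ 2).
  have -> : (T + b) ^+ 2 = T ^+ 2 + 2 * (T * b) + b ^+ 2 by ring.
  by rewrite Tb T2 b2; field.
have T10 : 0 <= 1 + T ^+ 2 by rewrite addr_ge0 ?sqr_ge0.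
move=> z /(kite_sides T b z K)[t t01 H].
case: H => [[->|->]|[->|->]].
- exists o2; apply: far4; rewrite K2 dist_vec2.
  have := sqr_ge0 ((1 + T ^+ 2) * t - 2); lra.
- exists o0; apply: far4; rewrite K0 dist_vec2.
  have := sqr_ge0 ((1 + T ^+ 2) * t - 2); lra.
- exists o1; apply: far4; apply: low; rewrite Tb2 mulrA ler_wpM2r // K1 dist_vec2.
  have := sqr_ge0 ((1 + b ^+ 2) * t + T * b - 1); lra.
- exists o1; apply: far4; apply: low; rewrite Tb2 mulrA ler_wpM2r // K1 dist_vec2.
  have := sqr_ge0 ((1 + b ^+ 2) * t + T * b - 1); lra.
Qed.

Lemma magic_kite_perimeter v : is_magic_kite v ->
  perimeter v <= 4 / 3 * Num.sqrt (3 + 2 * Num.sqrt 3) * self_chebyshev_radius (boundary v).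
Proof.
move=> [_ [f [k k0 df] bv]].
have fl := similarity_lerp f k df.
have finj x y : f x = f y -> x = y.
  move=> e; apply: dist_eq0; apply: (mulfI (lt0r_neq0 k0)).
  by rewrite -df e distxx mulr0.
have inb z : boundary kite z -> boundary v (f z) by rewrite bv => h; exists z.
have pre z : boundary v z -> exists2 z', boundary kite z' & f z' = z by rewrite bv.
have vertex j : exists i, v i = f (kite j).
  have /boundaryP[i [t t01 e]] := inb _ (vertex_on_boundary _ j).
  have [a ba fa] := pre _ (vertex_on_boundary v i).
  have [c bc fc] := pre _ (vertex_on_boundary v (ordS i)).
  rewrite -fa -fc -fl // in e.
  case: (kite_extreme j a c t ba bc t01 (finj _ _ e)) => <-; by [exists i|exists (ordS i)].
have diag j i : v i = f (kite j) -> v (ordS i) = f (kite (ordS (ordS j))) -> False.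
  move=> e1 e2; apply: (kite_no_diagonal j).
  have h01 : 0 <= (1 / 2 : R) <= 1 by lra.
  have : boundary v (lerp (1 / 2) (v i) (v (ordS i))) by apply/boundaryP; exists i, (1 / 2).
  by rewrite e1 e2 -fl // => /pre[z' bz /finj <-].
have [[n01 n02 n03] [n12 n13 n23]] := kite_distinct.
have [S0 S1 S2 S3] := ordS4.
have per : perimeter v = k * perimeter kite.
  have -> : k * perimeter kite =
      quad_perimeter (f (kite o0)) (f (kite o1)) (f (kite o2)) (f (kite o3)).
    by rewrite perimeterE /quad_perimeter !df; ring.
  apply: cyclic_order => //;
    try (by move=> /finj); by move=> i e1 e2; apply: (diag _ i e1); rewrite ?S0 ?S1 ?S2 ?S3 ?S0.
have [rho [E F]] := kite_far.
rewrite per -E mulrCA; apply: ler_wpM2l; first by rewrite mulr_ge0 ?sqrtr_ge0 // divr_ge0.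
apply: radius_lower => z /pre[z' bz <-]; have [j hj] := F _ bz.
exists (f (kite j)); first exact: inb (vertex_on_boundary _ j).
by rewrite df ler_pM2l.
Qed.

End Converse.

Theorem theorem1 (R : realType) (P : 'I_4 -> 'rV[R]_2) (hP : is_quadrilateral P) :
  4 / 3 * Num.sqrt (3 + 2 * Num.sqrt 3) * self_chebyshev_radius (boundary P)
    <= perimeter P /\
  (perimeter P =
     4 / 3 * Num.sqrt (3 + 2 * Num.sqrt 3) * self_chebyshev_radius (boundary P)
   <-> is_magic_kite P).
Proof.
have [H1 H2] := isoperimetric P hP; split=> //; split=> // K.
by apply/eqP; rewrite eq_le H1 magic_kite_perimeter.
Qed.
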